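(* Let $p$ be an odd prime. Then the theory $\mathrm{ES}_p$ of infinite extra-special $p$-groups is trace equivalent to $\mathrm{Vec}_p\sqcup\mathrm{Hyp}_2$.
   Context: All theories are first order, consistent and complete; ``definable'' means definable with parameters. An extra-special $p$-group is a group $\Gamma$ such that $a^p=1$ for all $a\in\Gamma$, the center and the commutator subgroup of $\Gamma$ agree, and the center is cyclic of order $p$; $\mathrm{ES}_p$ is complete. $\mathrm{Vec}_p$ is the theory of infinite $\mathbb F_p$-vector spaces. $\mathrm{Hyp}_2$ is the theory of the generic $2$-hypergraph, i.e. of the Erdős–Rado (random) graph. For theories $T_1,T_2$, $T_1\sqcup T_2$ is the theory of the disjoint union (a two-sorted structure, with no additional structure between the sorts) of a model of $T_1$ and a model of $T_2$; a structure with finitely many sorts is regarded as a one-sorted structure on the disjoint union of its sorts, with unary predicates for the sorts. A structure $\mathcal N$ trace defines a structure $\mathcal M$ if there is an injection $\tau\colon M\to N^n$ for some $n$ such that every $\mathcal M$-definable subset of every $M^m$ is of the form $\{(a_1,\dots,a_m)\in M^m:(\tau(a_1),\dots,\tau(a_m))\in Y\}$ for some $\mathcal N$-definable $Y\subseteq N^{nm}$. A theory trace defines another if every model of the second is trace definable in some model of the first. Two theories are trace equivalent if each trace defines the other. *)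

(* Defs.v *)
From HB Require Import structures.
From mathcomp Require Import all_boot all_order all_algebra.
From mathcomp Require Import boolp classical_sets functions cardinality.

Set Implicit Arguments.
Unset Strict Implicit.
Unset Printing Implicit Defensive.

Local Open Scope classical_set_scope.

Record language := Language {
  fsym : Type;
  rsym : Type;
  far : fsym -> nat;
  rar : rsym -> nat }.

Record structure (L : language) := Structure {
  carrier :> Type;
  carrier_inhabited : inhabited carrier;
  fint : forall f : fsym L, ('I_(far f) -> carrier) -> carrier;
  rint : forall r : rsym L, ('I_(rar r) -> carrier) -> Prop }.

Inductive term (L : language) (V : Type) : Type :=
| Var of V
| App (f : fsym L) of 'I_(far f) -> term L V.

(* [formula L V] is the type of L-formulas with free variables in V.  In
   [All phi] the bound variable is [None] and [Some x] is the outer variable x. *)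
Inductive formula (L : language) (V : Type) : Type :=
| Bot
| Eq of term L V & term L V
| Rel (r : rsym L) of 'I_(rar r) -> term L V
| Imp of formula L V & formula L V
| All of formula L (option V).

Fixpoint eval (L : language) (M : structure L) (V : Type) (v : V -> M)
    (t : term L V) : M :=
  match t with
  | Var x => v x
  | App f args => fint (fun i => eval v (args i))
  end.

Fixpoint sat (L : language) (M : structure L) (V : Type) (v : V -> M)
    (phi : formula L V) : Prop :=
  match phi, v with
  | Bot, _ => False
  | Eq t u, v => eval v t = eval v u
  | Rel r args, v => rint (fun i => eval v (args i))
  | Imp phi psi, v => sat v phi -> sat v psi
  | All phi, v => forall a : M, sat (oapp v a) phi
  end.

Definition sentence (L : language) : Type := formula L void.

Definition holds (L : language) (M : structure L) (phi : sentence L) : Prop :=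
  sat (M := M) (of_void M) phi.

Definition theory (L : language) : Type := set (sentence L).

Definition models (L : language) (M : structure L) (T : theory L) : Prop :=
  forall phi, T phi -> holds M phi.

(* Definability with parameters.  The coordinates of the power of M are indexed
   by an arbitrary finite type I; a variable [inr b] stands for the parameter b. *)
Definition definable (L : language) (M : structure L) (I : finType)
    (X : set (I -> M)) : Prop :=
  exists phi : formula L (I + M)%type,
    X = [set a | sat (fun x => match x with inl i => a i | inr b => b end) phi].

(* N^(nm) is indexed by the pairs (i, j) with i < m and j < n: the coordinate
   (i, j) of (tau a_1, ..., tau a_m) is the j-th coordinate of tau a_i. *)
Definition str_trace_defines (L1 L2 : language)
    (N : structure L1) (M : structure L2) : Prop :=
  exists (n : nat) (tau : M -> ('I_n -> N)),
    injective tau /\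
    forall (m : nat) (X : set ('I_m -> M)), definable X ->
      exists Y : set ('I_m * 'I_n -> N),
        definable Y /\ X = [set a | Y (fun ij => tau (a ij.1) ij.2)].

Definition trace_defines (L1 L2 : language)
    (T1 : theory L1) (T2 : theory L2) : Prop :=
  forall M2 : structure L2, models M2 T2 ->
    exists M1 : structure L1, models M1 T1 /\ str_trace_defines M1 M2.

Definition trace_equivalent (L1 L2 : language)
    (T1 : theory L1) (T2 : theory L2) : Prop :=
  trace_defines T1 T2 /\ trace_defines T2 T1.

(* On the disjoint union of the sorts a function symbol of one sort is only
   partially defined, so it is replaced by the relation symbol of its graph. *)
Inductive dunion_rsym (L1 L2 : language) : Type :=
| Sort1
| Sort2
| Graph1 of fsym L1
| Graph2 of fsym L2
| Rel1 of rsym L1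
| Rel2 of rsym L2.

Definition dunion_rar (L1 L2 : language) (r : dunion_rsym L1 L2) : nat :=
  match r with
  | Sort1 | Sort2 => 1
  | Graph1 f => (far f).+1
  | Graph2 f => (far f).+1
  | Rel1 r => rar r
  | Rel2 r => rar r
  end.

Definition dunion_lang (L1 L2 : language) : language :=
  {| fsym := void; rsym := dunion_rsym L1 L2;
     far := of_void nat; rar := @dunion_rar L1 L2 |}.

(* In a graph, coordinate 0 is the value and the others are the arguments. *)
Definition dunion_rint (L1 L2 : language) (M1 : structure L1) (M2 : structure L2)
    (r : dunion_rsym L1 L2) : ('I_(dunion_rar r) -> M1 + M2) -> Prop :=
  match r with
  | Sort1 => fun a => exists x, a ord0 = inl x
  | Sort2 => fun a => exists y, a ord0 = inr y
  | Graph1 f => fun a => exists b : 'I_(far f) -> M1,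
      a ord0 = inl (fint b) /\ forall i, a (lift ord0 i) = inl (b i)
  | Graph2 f => fun a => exists b : 'I_(far f) -> M2,
      a ord0 = inr (fint b) /\ forall i, a (lift ord0 i) = inr (b i)
  | Rel1 r => fun a => exists b : 'I_(rar r) -> M1,
      rint b /\ forall i, a i = inl (b i)
  | Rel2 r => fun a => exists b : 'I_(rar r) -> M2,
      rint b /\ forall i, a i = inr (b i)
  end.

Lemma dunion_inhabited (L1 L2 : language) (M1 : structure L1) (M2 : structure L2) :
  inhabited (M1 + M2).
Proof. by case: (carrier_inhabited M1) => x; exists; left. Qed.

Definition dunion (L1 L2 : language) (M1 : structure L1) (M2 : structure L2) :
    structure (dunion_lang L1 L2) :=
  @Structure (dunion_lang L1 L2) (M1 + M2)%type (dunion_inhabited M1 M2)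
    (fun f => match f with end) (@dunion_rint L1 L2 M1 M2).

Definition dunion_theory (L1 L2 : language) (T1 : theory L1) (T2 : theory L2) :
    theory (dunion_lang L1 L2) :=
  [set phi | forall (M1 : structure L1) (M2 : structure L2),
     models M1 T1 -> models M2 T2 -> holds (dunion M1 M2) phi].

Section ExtraSpecial.
Local Open Scope group_scope.

Definition center_set (G : groupType) : set G :=
  [set z | forall x, commute z x].

Definition commutator_set (G : groupType) : set G :=
  smallest [set H : set G | H 1 /\ forall x y, H x -> H y -> H (x / y)]
    [set c | exists x y, c = [~ x, y]].

Arguments center_set G : clear implicits.
Arguments commutator_set G : clear implicits.

Definition is_extraspecial (p : nat) (G : groupType) : Prop :=
  [/\ forall a : G, a ^+ p = 1,
      center_set G = commutator_set G,
      exists z : G, center_set G = range (fun k : nat => z ^+ k) &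
      (center_set G #= `I_p)%card].

Inductive group_fsym := GOne | GInv | GMul.

Definition group_far (f : group_fsym) : nat :=
  match f with GOne => 0 | GInv => 1 | GMul => 2 end.

Definition group_lang : language :=
  {| fsym := group_fsym; rsym := void; far := group_far; rar := of_void nat |}.

Definition group_fint (G : groupType) (f : group_fsym) :
    ('I_(group_far f) -> G) -> G :=
  match f with
  | GOne => fun=> 1
  | GInv => fun a => (a ord0)^-1
  | GMul => fun a => a ord0 * a ord_max
  end.

Definition group_structure (G : groupType) : structure group_lang :=
  @Structure group_lang G (inhabits 1) (@group_fint G)
    (fun r => match r with end).

(* The theory of a class of structures is the set of the sentences true in all its
   members; the choice operator contained in [groupType] exists classically. *)
Definition ES (p : nat) : theory group_lang :=
  [set phi | forall G : groupType, infinite_set [set: G] ->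
     is_extraspecial p G -> holds (group_structure G) phi].

End ExtraSpecial.

Section VectorSpaces.
Local Open Scope ring_scope.
Variable p : nat.

Inductive vec_fsym := VZero | VOpp | VAdd | VScale of 'F_p.

Definition vec_far (f : vec_fsym) : nat :=
  match f with VZero => 0 | VOpp => 1 | VAdd => 2 | VScale _ => 1 end.

Definition vec_lang : language :=
  {| fsym := vec_fsym; rsym := void; far := vec_far; rar := of_void nat |}.

Definition vec_fint (V : lmodType 'F_p) (f : vec_fsym) :
    ('I_(vec_far f) -> V) -> V :=
  match f with
  | VZero => fun=> 0
  | VOpp => fun a => - a ord0
  | VAdd => fun a => a ord0 + a ord_max
  | VScale c => fun a => c *: a ord0
  end.

Definition vec_structure (V : lmodType 'F_p) : structure vec_lang :=
  @Structure vec_lang V (inhabits 0) (@vec_fint V) (fun r => match r with end).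

Definition Vec : theory vec_lang :=
  [set phi | forall V : lmodType 'F_p, infinite_set [set: V] ->
     holds (vec_structure V) phi].

End VectorSpaces.

Arguments Vec p : clear implicits.

Definition is_random_graph (V : Type) (E : V -> V -> Prop) : Prop :=
  [/\ countable [set: V],
      forall x, ~ E x x,
      forall x y, E x y -> E y x &
      forall A B : set V, finite_set A -> finite_set B -> A `&` B = set0 ->
        exists v, [/\ ~ (A `|` B) v, forall a, A a -> E v a &
                      forall b, B b -> ~ E v b]].

Definition graph_lang : language :=
  {| fsym := void; rsym := unit; far := of_void nat; rar := fun=> 2 |}.

Definition graph_structure (V : Type) (V0 : inhabited V) (E : V -> V -> Prop) :
    structure graph_lang :=
  @Structure graph_lang V V0 (fun f => match f with end)
    (fun _ a => E (a ord0) (a ord_max)).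

(* By back-and-forth the random graph is unique up to isomorphism, so this is its
   complete theory. *)
Definition Hyp2 : theory graph_lang :=
  [set phi | forall (V : Type) (V0 : inhabited V) (E : V -> V -> Prop),
     is_random_graph E -> holds (graph_structure V0 E) phi].

(* Main.v *)
(** Truth of a formula on finite tuples of a structure M with a back-and-forth
    family of partial isomorphisms is decided by finitely many basic relations;
    so N trace defines M as soon as some injection M -> N^n makes the basic
    relations of M traces of definable sets of N.

    A model of the theory of a disjoint union is isomorphic to a disjoint union of
    models, since formulas of each sort translate into the language of the union.
    For a vector space V and a saturated graph on T, take the Heisenberg group of
    A = V x F_p^T: the elements given by evaluation at g in T and by the indicator
    function of the neighbours of h in T commute iff g and h are not adjacent.

    Conversely, for an extra-special group G with p odd, Baer's addition
    x + y = xy[x,y]^(-1/2) turns G into a vector space, on which the commutator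
    becomes an alternating form omega with values in the center <c>.  The type of
    a tuple is given by its linear relations modulo c, which the vector sort sees,
    and by the relations omega(x,y) = e, which are coded as edges of a graph; every
    graph embeds into a saturated one. *)

From HB Require Import structures.
From mathcomp Require Import all_boot all_algebra.
From mathcomp Require Import boolp classical_sets functions cardinality.
Require Import Defs.

Set Implicit Arguments.
Unset Strict Implicit.
Unset Printing Implicit Defensive.

Local Open Scope classical_set_scope.

(** * Formulas and expressible properties *)

(** Trace definability asks only for an injection: its image need be neither definable nor all of
    the power, and for each model M of one theory a model N of the other may be chosen. So N may
    contain much besides the image of M, such as the vertices added to saturate a graph or the full
    dual of A. The theories consist of the sentences true in a class, and a model need not belong to
    the class (a model of [Hyp2] may be uncountable); it is reached only through properties that
    sentences, or schemes of sentences, express. An edge relation is symmetric and two-valued,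
    whereas omega is antisymmetric with p values. Hence a group element receives 2p vertices, one
    for each value and each side of the form. Oddness of p enters twice: in the division by 2 of
    Baer's addition, and in the divisibility of 'C(p, 2) by p, which gives the Heisenberg group
    exponent p. *)

Section Formulas.
Variable L : language.

Fixpoint tmap (V W : Type) (f : V -> W) (t : term L V) : term L W :=
  match t with
  | Var x => Var L (f x)
  | App g args => App (fun i => tmap f (args i))
  end.

Fixpoint fmap (V : Type) (phi : formula L V) :
    forall W : Type, (V -> W) -> formula L W :=
  match phi with
  | Bot => fun W f => Bot L W
  | Eq t u => fun W f => Eq (tmap f t) (tmap f u)
  | Rel r args => fun W f => Rel (fun i => tmap f (args i))
  | Imp phi psi => fun W f => Imp (fmap phi f) (fmap psi f)
  | All phi => fun W f => All (fmap phi (omap f))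
  end.

Lemma eval_tmap (M : structure L) (V W : Type) (f : V -> W) (v : W -> M) t :
  eval v (tmap f t) = eval (v \o f) t.
Proof.
by elim: t => //= g args IH; congr fint; apply: funext => i; exact: IH.
Qed.

Lemma sat_fmap (M : structure L) (V W : Type) (f : V -> W) (v : W -> M)
  (phi : formula L V) : sat v (fmap phi f) <-> sat (v \o f) phi.
Proof.
elim: phi W f v => {V} //=.
- by move=> V t u W f v; rewrite !eval_tmap.
- move=> V r args W f v.
  by under eq_fun do rewrite eval_tmap.
- by move=> V phi IHphi psi IHpsi W f v; rewrite IHphi IHpsi.
- move=> V phi IH W f v; split=> + a => /(_ a); rewrite IH.
    by congr sat; apply: funext => -[].
  by congr sat; apply: funext => -[].
Qed.

Lemma sat_ext (M : structure L) (V : Type) (v w : V -> M) (phi : formula L V) :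
  v =1 w -> sat v phi <-> sat w phi.
Proof. by move=> /funext ->. Qed.

Definition Neg V (phi : formula L V) := Imp phi (Bot L V).
Definition And V (phi psi : formula L V) := Neg (Imp phi (Neg psi)).
Definition Ex V (phi : formula L (option V)) := Neg (All (Neg phi)).

Definition BigAnd V (K : finType) (F : K -> formula L V) :=
  foldr (fun k => And (F k)) (Neg (Bot L V)) (enum K).

(** Peels one variable off a block: index 0 becomes the variable bound by the next [All], and the
    other indices shift down by one. *)
Definition block_var (V : Type) n (x : V + 'I_n.+1) : option V + 'I_n :=
  match x with
  | inl y => inl (Some y)
  | inr i => if unlift ord0 i is Some j then inr j else inl None
  end.

Fixpoint AllBlock (V : Type) (n : nat) : formula L (V + 'I_n) -> formula L V :=
  match n with
  | 0 => fun phi => fmap phi (fun x => match x with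
           | inl y => y
           | inr i => False_rect V (notF (ltn_ord i))
           end)
  | n.+1 => fun phi => All (AllBlock (fmap phi (@block_var V n)))
  end.

Definition ExBlock (V : Type) n (phi : formula L (V + 'I_n)) := Neg (AllBlock (Neg phi)).

Definition sum_fun (T V W : Type) (v : V -> T) (w : W -> T) (x : V + W) : T :=
  match x with inl y => v y | inr z => w z end.

Variable M : structure L.

Lemma sat_Neg V (v : V -> M) phi : sat v (Neg phi) <-> ~ sat v phi.
Proof. by []. Qed.

Lemma sat_And V (v : V -> M) phi psi :
  sat v (And phi psi) <-> sat v phi /\ sat v psi.
Proof.
rewrite /And /=; split=> [H|[H1 H2] H3]; last exact: H3.
by split; apply: contrapT => H'; apply: H => // H1 H2.
Qed.

Lemma sat_Ex V (v : V -> M) phi : sat v (Ex phi) <-> exists a, sat (oapp v a) phi.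
Proof.
rewrite /Ex /=; split=> [H|[a Ha] H]; last exact: H Ha.
by apply: contrapT => H'; apply: H => a Ha; apply: H'; exists a.
Qed.

Lemma sat_BigAnd V (v : V -> M) (K : finType) (F : K -> formula L V) :
  sat v (BigAnd F) <-> forall k, sat v (F k).
Proof.
rewrite /BigAnd; have : forall k, k \in enum K by move=> k; rewrite mem_enum.
move: (enum K) => s Hs; transitivity (forall k, k \in s -> sat v (F k)); last first.
  by split=> H k; [exact: H|move=> _].
elim: s {Hs} => [|k s IH]; first by split=> // _; exact.
rewrite [foldr _ _ _]/= sat_And IH; split=> [[Hk Hs] l|H].
  by rewrite in_cons => /orP[/eqP ->|/Hs].
by split=> [|l Hl]; apply: H; rewrite in_cons ?eqxx ?Hl ?orbT.
Qed.

Lemma sat_AllBlock (V : Type) n (v : V -> M) (phi : formula L (V + 'I_n)) :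
  sat v (AllBlock phi) <-> forall a : 'I_n -> M, sat (sum_fun v a) phi.
Proof.
elim: n V v phi => [|n IH] V v phi.
  rewrite /= sat_fmap; split=> [H a|/(_ (fun i => False_rect M (notF (ltn_ord i))))].
    by move: H; congr sat; apply: funext => -[y //|[]].
  by congr sat; apply: funext => -[y //|[]].
rewrite /=; split=> [H a|H a].
  have /IH/(_ (a \o lift ord0)) := H (a ord0).
  rewrite sat_fmap; congr sat; apply: funext => -[y //|i] /=.
  by case: unliftP => [j ->|->].
apply/IH => b; rewrite sat_fmap.
have := H (fun i => if unlift ord0 i is Some j then b j else a).
by congr sat; apply: funext => -[y //|i] /=; case: unliftP.
Qed.

Lemma sat_ExBlock (V : Type) n (v : V -> M) (phi : formula L (V + 'I_n)) :
  sat v (ExBlock phi) <-> exists a : 'I_n -> M, sat (sum_fun v a) phi.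
Proof.
rewrite sat_Neg sat_AllBlock; split=> [H|[a Ha] /(_ a)]; last exact.
by apply: contrapT => H'; apply: H => a Ha; apply: H'; exists a.
Qed.

End Formulas.

Section Expressible.
Variables (L : language) (Idx : Type) (S : Idx -> structure L).

(** One formula has to serve all the structures [S i]. With the closure lemmas below, axioms are
    written as ordinary propositions and their formulas need never be displayed. *)
Definition expressible V (P : forall i, (V -> S i) -> Prop) :=
  exists phi : formula L V, forall i v, sat v phi <-> P i v.

Definition texpressible V (t : forall i, (V -> S i) -> S i) :=
  exists t' : term L V, forall i v, eval v t' = t i v.

Lemma texp_var V (x : V) : texpressible (fun i v => v x).
Proof. by exists (Var L x). Qed.

Lemma texp_app V (f : fsym L) (a : forall i, (V -> S i) -> 'I_(far f) -> S i) :
  (forall k, texpressible (fun i v => a i v k)) ->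
  texpressible (fun i v => fint (a i v)).
Proof.
move=> /choice[t Ht]; exists (App t) => i v /=.
by congr fint; apply: funext => k; exact: Ht.
Qed.

Lemma exp_bot V : expressible (fun i (v : V -> S i) => False).
Proof. by exists (Bot L V). Qed.

Lemma exp_eq V (t u : forall i, (V -> S i) -> S i) :
  texpressible t -> texpressible u -> expressible (fun i v => t i v = u i v).
Proof. by move=> [t' Ht] [u' Hu]; exists (Eq t' u') => i v /=; rewrite Ht Hu. Qed.

Lemma exp_rel V (r : rsym L) (a : forall i, (V -> S i) -> 'I_(rar r) -> S i) :
  (forall k, texpressible (fun i v => a i v k)) ->
  expressible (fun i v => rint (a i v)).
Proof.
move=> /choice[t Ht]; exists (Rel t) => i v /=.
by under eq_fun do rewrite Ht.
Qed.

Lemma exp_imp V (P Q : forall i, (V -> S i) -> Prop) :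
  expressible P -> expressible Q -> expressible (fun i v => P i v -> Q i v).
Proof. by move=> [p Hp] [q Hq]; exists (Imp p q) => i v /=; rewrite Hp Hq. Qed.

Lemma exp_all V (Q : forall i, (V -> S i) -> S i -> Prop) :
  expressible (fun i w => Q i (w \o Some) (w None)) ->
  expressible (fun i v => forall a, Q i v a).
Proof.
move=> [q Hq]; exists (All q) => i v /=.
by split=> H a; have := H a; rewrite Hq.
Qed.

Lemma exp_not V (P : forall i, (V -> S i) -> Prop) :
  expressible P -> expressible (fun i v => ~ P i v).
Proof. by move=> HP; apply: exp_imp => //; exact: exp_bot. Qed.

Lemma exp_and V (P Q : forall i, (V -> S i) -> Prop) :
  expressible P -> expressible Q -> expressible (fun i v => P i v /\ Q i v).
Proof. by move=> [p Hp] [q Hq]; exists (And p q) => i v; rewrite sat_And Hp Hq. Qed.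

Lemma exp_iff V (P Q : forall i, (V -> S i) -> Prop) :
  expressible P -> expressible Q -> expressible (fun i v => P i v <-> Q i v).
Proof. by move=> HP HQ; apply: exp_and; exact: exp_imp. Qed.

Lemma exp_ex V (Q : forall i, (V -> S i) -> S i -> Prop) :
  expressible (fun i w => Q i (w \o Some) (w None)) ->
  expressible (fun i v => exists a, Q i v a).
Proof.
move=> [q Hq]; exists (Ex q) => i v; rewrite sat_Ex.
by split=> -[a Ha]; exists a; apply/(Hq i (oapp v a)).
Qed.

Lemma exp_ext V (P Q : forall i, (V -> S i) -> Prop) :
  (forall i v, P i v <-> Q i v) -> expressible P -> expressible Q.
Proof. by move=> PQ [p Hp]; exists p => i v; rewrite Hp PQ. Qed.

Lemma exp_ren V W (f : V -> W) (P : forall i, (V -> S i) -> Prop) :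
  expressible P -> expressible (fun i v => P i (v \o f)).
Proof. by move=> [p Hp]; exists (fmap p f) => i v; rewrite sat_fmap Hp. Qed.

Lemma exp_fin V (K : finType) (P : K -> forall i, (V -> S i) -> Prop) :
  (forall k, expressible (P k)) -> expressible (fun i v => forall k, P k i v).
Proof.
move=> /choice[F HF]; exists (BigAnd F) => i v; rewrite sat_BigAnd.
by split=> H k; apply/HF; exact: H.
Qed.

Lemma exp_finex V (K : finType) (P : K -> forall i, (V -> S i) -> Prop) :
  (forall k, expressible (P k)) -> expressible (fun i v => exists k, P k i v).
Proof.
move=> HP; apply: (@exp_ext _ (fun i v => ~ forall k, ~ P k i v)).
  move=> i v; split=> [nall|[k Pk] /(_ k)//].
  by apply: contrapT => nex; apply: nall => k Pk; apply: nex; exists k.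
by apply: exp_not; apply: exp_fin => k; exact: exp_not.
Qed.

Lemma exp_block V n (Q : forall i, (V -> S i) -> ('I_n -> S i) -> Prop) :
  expressible (fun i w => Q i (w \o inl) (w \o inr)) ->
  expressible (fun i v => forall a, Q i v a).
Proof.
move=> [q Hq]; exists (AllBlock q) => i v; rewrite sat_AllBlock.
by split=> H a; have := H a; rewrite Hq.
Qed.

End Expressible.

Definition sentence_expressible L (P : structure L -> Prop) :=
  expressible (S := @id (structure L)) (fun M (_ : void -> M) => P M).

(** The sentence expressing P is itself one of the sentences common to K. This is the only access to
    a model of a theory that is defined by a class. *)
Lemma expressible_transfer L (K P : structure L -> Prop) (M : structure L) :
  sentence_expressible P -> (forall N, K N -> P N) ->
  (forall phi, (forall N, K N -> holds N phi) -> holds M phi) -> P M.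
Proof.
move=> [phi Hphi] KP HM; apply/(Hphi M (of_void M)).
by apply: HM => N /KP HN; apply/(Hphi N (of_void N)).
Qed.

Definition two (T : Type) (x y : T) (i : 'I_2) : T := if val i == 0 then x else y.

Definition no_args (T : Type) (i : 'I_0) : T := False_rect T (notF (ltn_ord i)).

Lemma two_eta (T : Type) (a : 'I_2 -> T) : a = two (a ord0) (a ord_max).
Proof. by apply: funext => -[[|[|//]] Hi]; congr a; apply: val_inj. Qed.

Lemma no_args_eta (T : Type) (a : 'I_0 -> T) : a = @no_args T.
Proof. by apply: funext => -[]. Qed.

Lemma one_eta (T : Type) (a : 'I_1 -> T) : a = fun=> a ord0.
Proof. by apply: funext => i; rewrite (ord1 i). Qed.

(** Infinity is not one sentence but the scheme of these over all n. *)
Definition infinite_structure n L (M : structure L) :=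
  forall a : 'I_n -> M, exists x, forall i, x <> a i.

Lemma infinite_structure_expressible n L : sentence_expressible (@infinite_structure n L).
Proof.
apply: exp_block; apply: exp_ex; apply: exp_fin => i; apply: exp_not.
by apply: exp_eq; exact: texp_var.
Qed.

Lemma finite_set_range (T : Type) (A : set T) :
  finite_set A <-> exists n (a : 'I_n -> T), A = range a.
Proof.
split=> [/(@finite_seqP {classic T})[s ->]|[n [a ->]]].
  exists (size s), (fun i => tnth (in_tuple s) i); apply/seteqP; split=> x /=.
    by move=> /(@seq_tnthP {classic T})[i ->]; exists i.
  by move=> [i _ <-]; exact: mem_tnth.
exact: finite_image.
Qed.

Lemma infinite_structureP L (M : structure L) :
  infinite_set [set: M] <-> forall n, infinite_structure n M.
Proof.
split=> [infM n a|H /finite_set_range[n [a Ea]]].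
  apply: contrapT => /forallNP nex; apply: infM; apply/finite_set_range.
  exists n, a; apply/seteqP; split=> // x _.
  by have /existsNP[i /contrapT ->] := nex x; exists i.
have [x Hx] := H n a.
by have : [set: M] x by []; rewrite Ea => -[i _ /esym/Hx].
Qed.

(** * Models of the theory of a disjoint union *)

Section RelativeInterpretation.
Variables (L L' : language) (dom : formula L' unit).
Variable graph : forall f : fsym L, formula L' (option 'I_(far f)).
Variable rel : forall r : rsym L, formula L' 'I_(rar r).

Definition in_dom (M' : structure L') (x : M') := sat (fun=> x) dom.

(** [i] is an isomorphism of M onto the L-structure that [dom], [graph] and [rel] define inside M'.
    The formulas are fixed while both structures vary, so that one translation serves all of
    them. *)
Definition is_part (M' : structure L') (M : structure L) (i : M -> M') :=
  [/\ injective i,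
      forall x, in_dom x <-> exists a, x = i a,
      forall f y x, sat (oapp (i \o y) x) (graph f) <-> x = i (fint y) &
      forall r y, sat (i \o y) (rel r) <-> rint y].

Definition dom_formula V (x : V) : formula L' V := fmap dom (fun=> x).

Lemma sat_dom_formula (M' : structure L') V (v : V -> M') x :
  sat v (dom_formula x) <-> in_dom (v x).
Proof. by rewrite sat_fmap. Qed.

(** A function symbol of L is only a graph in L', so nested terms are unravelled: existential
    variables hold the values of the subterms. *)
Lemma term_translation V (t : term L V) :
  exists phi : formula L' (option V),
    forall (M' : structure L') (M : structure L) (i : M -> M'), is_part i ->
    forall (v : V -> M) (x : M'),
    sat (oapp (i \o v) x) phi <-> x = i (eval v t).
Proof.
elim: t => [y|f args /choice[F HF]].
  by exists (Eq (Var L' None) (Var L' (Some y))) => M' M i _ v x.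
pose graph_args := fmap (graph f)
  (fun o => if o is Some k then inr k else inl None : option V + 'I_(far f)).
pose arg k := fmap (F k)
  (fun o => if o is Some y then inl (Some y) else inr k : option V + 'I_(far f)).
exists (ExBlock (And graph_args (BigAnd arg))) => M' M i Hi v x.
have Hi' := Hi; case: Hi' => _ _ Hgraph _.
have Earg b k : sat (sum_fun (oapp (i \o v) x) b) (arg k) <->
    b k = i (eval v (args k)).
  rewrite sat_fmap -(HF k M' M i Hi v (b k)).
  by apply: sat_ext => -[].
have Egraph b : (forall k, b k = i (eval v (args k))) ->
    sat (sum_fun (oapp (i \o v) x) b) graph_args <->
    x = i (fint (fun k => eval v (args k))).
  move=> Hb; rewrite sat_fmap -Hgraph.
  by apply: sat_ext => -[k|] //=; exact: Hb.
rewrite sat_ExBlock; split=> [[b]|Hx].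
  rewrite sat_And sat_BigAnd => -[Hg Hb].
  by apply: (proj1 (Egraph b _) Hg) => k; apply/Earg.
exists (fun k => i (eval v (args k))); rewrite sat_And sat_BigAnd.
by split=> [|k]; [exact/Egraph|exact/Earg].
Qed.

Lemma formula_translation V (phi : formula L V) :
  exists phi' : formula L' V,
    forall (M' : structure L') (M : structure L) (i : M -> M'), is_part i -> forall v : V -> M,
    sat (i \o v) phi' <-> sat v phi.
Proof.
elim: phi => {V} [V|V t u|V r args|V phi [phi' Hphi] psi [psi' Hpsi]|V phi [phi' Hphi]].
- by exists (Bot L' V).
- have [t' Ht] := term_translation t; have [u' Hu] := term_translation u.
  exists (Ex (And t' u')) => M' M i Hi v; rewrite sat_Ex; split.
    move=> [x]; rewrite sat_And (Ht _ _ _ Hi) (Hu _ _ _ Hi) => -[-> E].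
    by case: Hi => Hi _ _ _; apply: Hi.
  move=> E; exists (i (eval v t)).
  by rewrite sat_And (Ht _ _ _ Hi) (Hu _ _ _ Hi) (E : eval v t = eval v u).
- have /choice[F HF] := fun k => term_translation (args k).
  pose arg k := fmap (F k)
    (fun o => if o is Some y then inl y else inr k : V + 'I_(rar r)).
  exists (ExBlock (And (fmap (rel r) inr) (BigAnd arg))) => M' M i Hi v.
  have Hi' := Hi; case: Hi' => _ _ _ Hrel.
  have Earg b k : sat (sum_fun (i \o v) b) (arg k) <->
      b k = i (eval v (args k)).
    rewrite sat_fmap -(HF k M' M i Hi v (b k)).
    by apply: sat_ext => -[].
  rewrite sat_ExBlock [sat v _]/= -Hrel; split=> [[b]|H].
    rewrite sat_And sat_BigAnd sat_fmap => -[+ Hb]; congr sat.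
    by apply: funext => k /=; apply/Earg; exact: Hb.
  exists (fun k => i (eval v (args k))); rewrite sat_And sat_BigAnd sat_fmap.
  by split=> // k; exact/Earg.
- exists (Imp phi' psi') => M' M i Hi v /=.
  by rewrite (Hphi _ _ _ Hi) (Hpsi _ _ _ Hi).
- exists (All (Imp (dom_formula None) phi')) => M' M i Hi v /=.
  have E a : i \o oapp v a = oapp (i \o v) (i a) by apply: funext => -[].
  split=> [H a|H x].
    rewrite -(Hphi _ _ _ Hi) E; apply: H; rewrite sat_dom_formula /=.
    by case: Hi => _ Hdom _ _; apply/Hdom; exists a.
  rewrite sat_dom_formula /=; case: (Hi) => _ Hdom _ _ /Hdom[a ->].
  by rewrite -E (Hphi _ _ _ Hi).
Qed.

Definition dom_nonempty (M' : structure L') := exists x : M', in_dom x.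

Definition graph_total (f : fsym L) (M' : structure L') :=
  forall y : 'I_(far f) -> M', (forall k, in_dom (y k)) ->
  exists x, in_dom x /\ forall x', sat (oapp y x') (graph f) <-> x' = x.

Lemma dom_nonempty_expressible : sentence_expressible dom_nonempty.
Proof.
by apply: exp_ex; exists (dom_formula None) => M v; rewrite sat_dom_formula.
Qed.

Lemma graph_total_expressible f : sentence_expressible (graph_total f).
Proof.
apply: exp_block; apply: exp_imp.
  apply: exp_fin => k.
  by exists (dom_formula (inr k)) => M v; rewrite sat_dom_formula.
apply: exp_ex; apply: exp_and.
  by exists (dom_formula None) => M v; rewrite sat_dom_formula.
apply: exp_all; apply: exp_iff; last by apply: exp_eq; exact: texp_var.
exists (fmap (graph f) (fun o => if o is Some k then Some (Some (inr k)) else None)).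
move=> M v; rewrite sat_fmap.
by apply: sat_ext => -[].
Qed.

Lemma part_nonempty (M' : structure L') (M : structure L) (i : M -> M') :
  is_part i -> dom_nonempty M'.
Proof.
by move=> [_ Hdom _ _]; case: (carrier_inhabited M) => a; exists (i a); apply/Hdom; exists a.
Qed.

Lemma part_total (M' : structure L') (M : structure L) (i : M -> M') f :
  is_part i -> graph_total f M'.
Proof.
move=> [_ Hdom Hgraph _] y /= Hy.
have /choice[b Hb] : forall k, exists a, y k = i a by move=> k; apply/Hdom.
have -> : y = i \o b by apply: funext.
exists (i (fint b)); split=> [|x]; last exact: Hgraph.
by apply/Hdom; exists (fint b).
Qed.

Lemma part_exists (M' : structure L') :
  dom_nonempty M' -> (forall f, graph_total f M') ->
  exists (M : structure L) (i : M -> M'), is_part i.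
Proof.
move=> [x0 Hx0] Htot.
pose C := {x : M' | in_dom x}.
have Hf f : forall y : 'I_(far f) -> C, exists c : C, forall x : M',
    sat (oapp (sval \o y) x) (graph f) <-> x = sval c.
  move=> y; have [|x [Hx E]] := Htot f (sval \o y); first by move=> k; exact: svalP.
  by exists (exist _ x Hx).
pose F f y := sval (cid (Hf f y)).
exists (@Structure L C (inhabits (exist _ x0 Hx0)) F
  (fun r y => sat (sval \o y) (rel r))), sval; split=> //.
- by move=> [x Hx] [y Hy] /= E; apply: eq_exist.
- by move=> x; split=> [Hx|[a ->]]; [exists (exist _ x Hx)|exact: svalP].
- by move=> f y x; rewrite /= /F; case: cid.
Qed.

(** Nonemptiness of the domain, totality of the graphs and the translated axioms hold throughout K,
    hence in M', where they make the structure cut out by the formulas a model of T. *)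
Lemma part_transfer (T : theory L) (K : structure L' -> Prop) (M' : structure L') :
  (forall N', K N' -> exists (N : structure L) (i : N -> N'), is_part i /\ models N T) ->
  (forall phi, (forall N, K N -> holds N phi) -> holds M' phi) ->
  exists (M : structure L) (i : M -> M'), is_part i /\ models M T.
Proof.
move=> KT HM'.
have [||M [i Hi]] := @part_exists M'.
- apply: expressible_transfer HM'; first exact: dom_nonempty_expressible.
  by move=> N /KT[N' [i [Hi _]]]; exact: part_nonempty Hi.
- move=> f; apply: expressible_transfer HM'; first exact: graph_total_expressible.
  by move=> N /KT[N' [i [Hi _]]]; exact: part_total Hi.
exists M, i; split=> // phi Tphi.
have [phi' Hphi] := formula_translation phi.
have E (N' : structure L') (N : structure L) (j : N -> N') :
    is_part j -> holds N' phi' <-> holds N phi.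
  move=> Hj; rewrite /holds -(Hphi _ _ _ Hj).
  by apply: sat_ext => -[].
apply/(E _ _ _ Hi)/HM' => N /KT[N' [j [Hj HN']]].
by apply/(E _ _ _ Hj)/HN'.
Qed.

End RelativeInterpretation.

Definition isomorphism L (M N : structure L) (h : M -> N) :=
  [/\ bijective h,
      forall f a, h (fint a) = fint (f := f) (h \o a) &
      forall r a, rint a <-> rint (r := r) (h \o a)].

Lemma inj_surj_bij (T U : Type) (h : T -> U) :
  injective h -> (forall y, exists x, y = h x) -> bijective h.
Proof.
move=> inj_h /choice[g Hg]; exists g => x; last by rewrite -Hg.
by apply: inj_h; rewrite -Hg.
Qed.

Section DisjointUnion.
Variables L1 L2 : language.
Local Notation L := (dunion_lang L1 L2).

Definition dom1 : formula L unit := @Rel L unit (Sort1 L1 L2) (fun=> Var L tt).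
Definition dom2 : formula L unit := @Rel L unit (Sort2 L1 L2) (fun=> Var L tt).
(** [unlift ord0] sends coordinate 0, the value, to [None] and each argument to its own index. *)
Definition graph1 (f : fsym L1) : formula L (option 'I_(far f)) :=
  @Rel L _ (Graph1 L2 f) (fun k : 'I_(far f).+1 => Var L (unlift ord0 k)).
Definition graph2 (f : fsym L2) : formula L (option 'I_(far f)) :=
  @Rel L _ (Graph2 L1 f) (fun k : 'I_(far f).+1 => Var L (unlift ord0 k)).
Definition rel1 (r : rsym L1) : formula L 'I_(rar r) :=
  @Rel L _ (Rel1 L2 r) (fun k => Var L k).
Definition rel2 (r : rsym L2) : formula L 'I_(rar r) :=
  @Rel L _ (Rel2 L1 r) (fun k => Var L k).

Section Parts.
Variables (M1 : structure L1) (M2 : structure L2).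
Local Notation M := (dunion M1 M2).

Lemma dunion_part1 : is_part dom1 graph1 rel1 (inl : M1 -> M).
Proof.
split=> [x y [] //|x|f y x|r y] /=.
- by split.
- rewrite /= unlift_none /=; split=> [[b [-> Hb]]|->].
    congr (inl (fint _)); apply: funext => k.
    by have := Hb k; rewrite liftK /= => -[].
  by exists y; split=> // k; rewrite liftK.
- split=> [[b [Hb E]]|Hy]; last by exists y.
  by have -> : y = b by apply: funext => k; case: (E k).
Qed.

Lemma dunion_part2 : is_part dom2 graph2 rel2 (inr : M2 -> M).
Proof.
split=> [x y [] //|x|f y x|r y] /=.
- by split.
- rewrite /= unlift_none /=; split=> [[b [-> Hb]]|->].
    congr (inr (fint _)); apply: funext => k.
    by have := Hb k; rewrite liftK /= => -[].
  by exists y; split=> // k; rewrite liftK.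
- split=> [[b [Hb E]]|Hy]; last by exists y.
  by have -> : y = b by apply: funext => k; case: (E k).
Qed.

End Parts.

Lemma part1_graph (M : structure L) (M1 : structure L1) (i : M1 -> M)
  (f : fsym L1) (b : 'I_(far f).+1 -> M1) :
  is_part dom1 graph1 rel1 i ->
  @rint L M (Graph1 L2 f) (i \o b) <-> b ord0 = fint (b \o lift ord0).
Proof.
move=> [inj_i _ G _]; have /= := G f (b \o lift ord0) (i (b ord0)).
have -> : (fun k : 'I_(far f).+1 => oapp (i \o (b \o lift ord0)) (i (b ord0))
    (unlift ord0 k)) = i \o b.
  by apply: funext => k; case: unliftP => [j ->|->].
by move=> ->; split=> [/inj_i|->].
Qed.

Lemma part2_graph (M : structure L) (M2 : structure L2) (i : M2 -> M)
  (f : fsym L2) (b : 'I_(far f).+1 -> M2) :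
  is_part dom2 graph2 rel2 i ->
  @rint L M (Graph2 L1 f) (i \o b) <-> b ord0 = fint (b \o lift ord0).
Proof.
move=> [inj_i _ G _]; have /= := G f (b \o lift ord0) (i (b ord0)).
have -> : (fun k : 'I_(far f).+1 => oapp (i \o (b \o lift ord0)) (i (b ord0))
    (unlift ord0 k)) = i \o b.
  by apply: funext => k; case: unliftP => [j ->|->].
by move=> ->; split=> [/inj_i|->].
Qed.

Definition sort_disjoint (M : structure L) :=
  forall x : M, in_dom dom1 x <-> ~ in_dom dom2 x.

Lemma sort_disjoint_expressible : sentence_expressible sort_disjoint.
Proof.
apply: exp_all; apply: exp_iff; last apply: exp_not.
  by exists (dom_formula dom1 None) => M v; rewrite sat_dom_formula.
by exists (dom_formula dom2 None) => M v; rewrite sat_dom_formula.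
Qed.

Lemma dunion_sort_disjoint M1 M2 : sort_disjoint (@dunion L1 L2 M1 M2).
Proof.
by move=> [x|x]; split=> [[y] // Ex [z]|] //=; [move=> _; exists x|case; exists x].
Qed.

(** The two parts of a structure say nothing about mixed tuples; this condition makes every relation
    fail on them. *)
Definition rel_sorted (dom : formula L unit) (r : rsym L) (M : structure L) :=
  forall y : 'I_(rar r) -> M, rint y -> forall k, in_dom dom (y k).

Lemma rel_sorted_expressible dom r : sentence_expressible (rel_sorted dom r).
Proof.
apply: exp_block; apply: exp_imp; first by apply: exp_rel => k; exact: texp_var.
apply: exp_fin => k.
by exists (dom_formula dom (inr k)) => M v; rewrite sat_dom_formula.
Qed.

Definition home (r : rsym L) : formula L unit :=
  match r with
  | Sort1 | Graph1 _ | Rel1 _ => dom1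
  | Sort2 | Graph2 _ | Rel2 _ => dom2
  end.

Lemma dunion_rel_sorted M1 M2 r : rel_sorted (home r) r (@dunion L1 L2 M1 M2).
Proof.
case: r => [||f|f|r|r] y /=.
- by move=> Hy k; rewrite ord1.
- by move=> Hy k; rewrite ord1.
- move=> [b [Hy0 Hy]] k; case: (unliftP ord0 k) => [j ->|->]; last by eexists; exact: Hy0.
  by eexists; exact: Hy.
- move=> [b [Hy0 Hy]] k; case: (unliftP ord0 k) => [j ->|->]; last by eexists; exact: Hy0.
  by eexists; exact: Hy.
- by move=> [b [_ Hy]] k; eexists; exact: Hy.
- by move=> [b [_ Hy]] k; eexists; exact: Hy.
Qed.

Variables (T1 : theory L1) (T2 : theory L2).

Lemma dunion_theory_split (M : structure L) : models M (dunion_theory T1 T2) ->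
  exists (M1 : structure L1) (M2 : structure L2) (h : dunion M1 M2 -> M),
    [/\ models M1 T1, models M2 T2 & isomorphism h].
Proof.
move=> HM.
pose K (N : structure L) := exists M1 M2, [/\ models M1 T1, models M2 T2 & N = dunion M1 M2].
have {}HM phi : (forall N, K N -> holds N phi) -> holds M phi.
  by move=> H; apply: HM => M1 M2 H1 H2; apply: H; exists M1, M2.
have [|M1 [i1 [Hi1 HM1]]] := @part_transfer _ _ dom1 graph1 rel1 T1 K M _ HM.
  move=> _ [M1 [M2 [HM1 _ ->]]]; exists M1, inl; split=> //; exact: dunion_part1.
have [|M2 [i2 [Hi2 HM2]]] := @part_transfer _ _ dom2 graph2 rel2 T2 K M _ HM.
  move=> _ [M1' [M2 [_ HM2 ->]]]; exists M2, inr; split=> //; exact: dunion_part2.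
have disjM : sort_disjoint M.
  apply: expressible_transfer HM; first exact: sort_disjoint_expressible.
  by move=> _ [? [? [_ _ ->]]]; exact: dunion_sort_disjoint.
have sortM r : rel_sorted (home r) r M.
  apply: expressible_transfer HM; first exact: rel_sorted_expressible.
  by move=> _ [? [? [_ _ ->]]]; exact: dunion_rel_sorted.
pose h (x : dunion M1 M2) : M := match x with inl y => i1 y | inr y => i2 y end.
have [inj1 D1 G1 R1] := Hi1; have [inj2 D2 G2 R2] := Hi2.
have disj x y : i1 x <> i2 y.
  move=> E; have : in_dom dom1 (i1 x) by apply/D1; exists x.
  by move=> /disjM; apply; apply/D2; exists y.
have h1 z : in_dom dom1 (h z) -> exists x, z = inl x.
  by case: z => x; [exists x|move=> /D1[a /esym/disj]].
have h2 z : in_dom dom2 (h z) -> exists x, z = inr x.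
  by case: z => x; [move=> /D2[a /disj]|exists x].
exists M1, M2, h; split=> //; split=> [|[]|r a].
  apply: inj_surj_bij.
    move=> [x|x] [y|y] //=; first by move=> /inj1 ->.
    - by move=> /disj.
    - by move=> /esym/disj.
    by move=> /inj2 ->.
  move=> y; have [/D1[a ->]|/disjM] := EM (in_dom dom1 y); first by exists (inl a).
  have [/D2[a ->]|n2 n1] := EM (in_dom dom2 y); first by exists (inr a).
  by case: (n1); apply/disjM.
have sorted1 n (c : 'I_n -> dunion M1 M2) : (forall k, in_dom dom1 (h (c k))) ->
    exists b, c = inl \o b.
  move=> Hc; have /choice[b Hb] := fun k => h1 _ (Hc k).
  by exists b; apply: funext.
have sorted2 n (c : 'I_n -> dunion M1 M2) : (forall k, in_dom dom2 (h (c k))) ->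
    exists b, c = inr \o b.
  move=> Hc; have /choice[b Hb] := fun k => h2 _ (Hc k).
  by exists b; apply: funext.
have lift_dom z : (in_dom dom1 z -> in_dom dom1 (h z)) /\ (in_dom dom2 z -> in_dom dom2 (h z)).
  by case: z => x; split=> [] // [y //] _; [apply/D1|apply/D2]; exists x.
(* Truth of either side puts the whole tuple into the home sort of r, so the relations need
   comparing on that sort only. *)
suff E : (forall k, in_dom (home r) (h (a k))) -> rint a <-> rint (r := r) (h \o a).
  split=> Ha; last by apply/E => // k; exact: sortM Ha k.
  apply/E => // k; have := dunion_rel_sorted Ha k.
  by case: (r) => *; apply: (lift_dom _).1 || apply: (lift_dom _).2.
case: r a => [||f|f|r|r] a Ha.
- split=> _; last by have [b ->] := sorted1 _ _ Ha; exists (b ord0).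
  by have -> : h \o a = fun=> h (a ord0); [apply: funext => k; rewrite /= (ord1 k)|exact: Ha].
- split=> _; last by have [b ->] := sorted2 _ _ Ha; exists (b ord0).
  by have -> : h \o a = fun=> h (a ord0); [apply: funext => k; rewrite /= (ord1 k)|exact: Ha].
- have [b ->] := sorted1 _ _ Ha.
  by rewrite (part1_graph _ (dunion_part1 M1 M2)) (part1_graph _ Hi1).
- have [b ->] := sorted2 _ _ Ha.
  by rewrite (part2_graph _ (dunion_part2 M1 M2)) (part2_graph _ Hi2).
- have [b ->] := sorted1 _ _ Ha; have [_ _ _ R] := dunion_part1 M1 M2.
  exact: iff_trans (R r b) (iff_sym (R1 r b)).
- have [b ->] := sorted2 _ _ Ha; have [_ _ _ R] := dunion_part2 M1 M2.
  exact: iff_trans (R r b) (iff_sym (R2 r b)).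
Qed.

End DisjointUnion.

(** * Back-and-forth and the criterion for trace definability *)

(** By [bf_fint] the domain of a member is closed under the function symbols, so that terms of any
    depth stay inside it and atomic formulas are preserved. *)
Record back_and_forth L (M N : structure L) (F : (M -> N -> Prop) -> Prop) := BackAndForth {
  bf_inj : forall R a b a' b', F R -> R a b -> R a' b' -> a = a' <-> b = b';
  bf_fint : forall R f a b, F R -> (forall i, R (a i) (b i)) ->
    R (fint (f := f) a) (fint (f := f) b);
  bf_rint : forall R r a b, F R -> (forall i, R (a i) (b i)) ->
    rint (r := r) a <-> rint (r := r) b;
  bf_forth : forall R a, F R ->
    exists R' b, [/\ F R', (forall x y, R x y -> R' x y) & R' a b];
  bf_back : forall R b, F R ->
    exists R' a, [/\ F R', (forall x y, R x y -> R' x y) & R' a b] }.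

Section BackAndForth.
Variables (L : language) (M N : structure L) (F : (M -> N -> Prop) -> Prop).
Hypothesis HF : back_and_forth F.

Lemma bf_eval V (t : term L V) R (v : V -> M) (w : V -> N) :
  F R -> (forall x, R (v x) (w x)) -> R (eval v t) (eval w t).
Proof.
by move=> FR Rvw; elim: t => //= f args IH; exact: bf_fint HF _ _ _ _ FR IH.
Qed.

Lemma bf_sat V (phi : formula L V) R (v : V -> M) (w : V -> N) :
  F R -> (forall x, R (v x) (w x)) -> sat v phi <-> sat w phi.
Proof.
elim: phi R v w => {V} //=.
- by move=> V t u R v w FR Rvw; apply: (bf_inj HF FR); exact: bf_eval.
- move=> V r args R v w FR Rvw; apply: (bf_rint HF FR) => i; exact: bf_eval.
- by move=> V phi IHphi psi IHpsi R v w FR Rvw; rewrite (IHphi R v w) ?(IHpsi R v w).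
- move=> V phi IH R v w FR Rvw; split=> H a.
    have [R' [b [FR' RR' R'ba]]] := bf_back HF a FR.
    by apply/(IH R' (oapp v b)) => // -[x|] //=; exact: RR'.
  have [R' [b [FR' RR' R'ab]]] := bf_forth HF a FR.
  by apply/(IH R' _ (oapp w b)) => // -[x|] //=; exact: RR'.
Qed.

End BackAndForth.

(** The graph of h is by itself a back-and-forth family with one member. *)
Lemma sat_isomorphism L (M N : structure L) (h : M -> N) V (phi : formula L V)
  (v : V -> M) : isomorphism h -> sat v phi <-> sat (h \o v) phi.
Proof.
move=> [[g hK gK] Hf Hr].
pose F R := R = (fun a b => b = h a).
apply: (@bf_sat _ _ _ F _ _ _ (fun a b => b = h a)) => //; split.
- move=> _ a b a' b' -> -> ->; split=> [->//|]; exact: (can_inj hK).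
- move=> _ f a b -> Hab; rewrite Hf; congr fint; exact: funext.
- by move=> _ r a b -> Hab; rewrite Hr; have -> : b = h \o a by exact: funext.
- by move=> R a FR; exists R, (h a); split=> //; rewrite FR.
- by move=> R b FR; exists R, (g b); split=> //; rewrite FR gK.
Qed.

(** * Formulas involve finitely many variables *)

Section FiniteSupport.
Variable L : language.

(** Each argument of a symbol brings its own finite set of variables; the tagged union of these sets
    serves all arguments at once. *)
Lemma finite_support_family n V (P : 'I_n -> forall W : finType, (W -> V) -> Prop) :
  (forall k, exists (W : finType) (g : W -> V), P k W g) ->
  exists (W : 'I_n -> finType) (g : {i : 'I_n & W i} -> V),
    forall k, P k (W k) (fun w => g (Tagged W w)).
Proof.
move=> HP.
have [W HW] := choice HP.
exists W, (fun w : {i : 'I_n & W i} => sval (cid (HW (tag w))) (tagged w)) => k /=.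
by case: cid.
Qed.

Lemma finite_support_term V (t : term L V) :
  exists (W : finType) (g : W -> V) (t' : term L W),
    forall (M : structure L) (v : V -> M), eval v t = eval (v \o g) t'.
Proof.
elim: t => [x|f args IH].
  by exists unit, (fun=> x), (Var L tt).
have [W [g Hg]] := finite_support_family IH; pose t' k := sval (cid (Hg k)).
have Ht k := svalP (cid (Hg k)) : forall (M : structure L) (v : V -> M), _ = eval _ (t' k).
exists {i : 'I_(far f) & W i}, g, (App (fun k => tmap (Tagged W) (t' k))) => M v /=.
by congr fint; apply: funext => k; rewrite Ht eval_tmap.
Qed.

(** [definable] provides a variable for every element of the structure, whereas a type is decided by
    finitely many relations only on a finite tuple. *)
Lemma finite_support V (phi : formula L V) :
  exists (W : finType) (g : W -> V) (psi : formula L W),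
    forall (M : structure L) (v : V -> M), sat v phi <-> sat (v \o g) psi.
Proof.
elim: phi => {V} [V|V t u|V r args|V phi IHphi psi IHpsi|V phi IH].
- by exists void, (of_void V), (Bot L void).
- have [W [g [t' Ht]]] := finite_support_term t.
  have [W' [g' [u' Hu]]] := finite_support_term u.
  exists (W + W')%type, (sum_fun g g'), (Eq (tmap inl t') (tmap inr u')) => M v /=.
  by rewrite !eval_tmap Ht Hu.
- have [W [g Hg]] := finite_support_family (fun k => finite_support_term (args k)).
  pose t k := sval (cid (Hg k)).
  have Ht k := svalP (cid (Hg k)) : forall (M : structure L) (v : V -> M), _ = eval _ (t k).
  exists {i : 'I_(rar r) & W i}, g, (Rel (fun k => tmap (Tagged W) (t k))) => M v /=.
  by under eq_fun do rewrite Ht -(eval_tmap (Tagged W) (v \o g)).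
- have [W [g [phi' Hphi]]] := IHphi; have [W' [g' [psi' Hpsi]]] := IHpsi.
  exists (W + W')%type, (sum_fun g g'), (Imp (fmap phi' inl) (fmap psi' inr)) => M v /=.
  by rewrite !sat_fmap Hphi Hpsi.
- have [W [g [psi Hpsi]]] := IH.
  have /choice[g' Hg'] : forall w : {w | g w}, exists x, g (val w) = Some x.
    by move=> [w]; case Ew : (g w) => [x|//] _; exists x.
  (* The variables that [g] sends to [None] are the ones bound by the quantifier, and [insub]
     returns [None] exactly on them. *)
  exists {w | g w}, g', (All (fmap psi insub)) => M v /=.
  suff E a : oapp (v \o g') a \o insub = oapp v a \o g.
    by split=> H a; have := H a; rewrite Hpsi sat_fmap E.
  apply: funext => w /=; case: insubP => [w' _ <-|]; first by rewrite Hg'.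
  by case: (g w).
Qed.

End FiniteSupport.

Section TraceCriterion.
Variables (L1 L2 : language) (N : structure L1) (M : structure L2).
Variables (J : finType) (tau : M -> J -> N).

Definition tau_val (V : Type) (a : V -> M) : (V * J) + N -> N :=
  sum_fun (fun ij => tau (a ij.1) ij.2) id.

(** Boolean operations preserve this notion. A quantifier over M has no evident counterpart in N, as
    the image of [tau] need not be definable; hence the detour through back-and-forth. *)
Definition traced (V : Type) (X : (V -> M) -> Prop) :=
  exists phi : formula L1 ((V * J) + N), forall a, sat (tau_val a) phi <-> X a.

Lemma traced_not V (X : (V -> M) -> Prop) : traced X -> traced (fun a => ~ X a).
Proof. by move=> [phi Hphi]; exists (Neg phi) => a; rewrite sat_Neg Hphi. Qed.

Lemma traced_and V (X Y : (V -> M) -> Prop) :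
  traced X -> traced Y -> traced (fun a => X a /\ Y a).
Proof.
by move=> [phi Hphi] [psi Hpsi]; exists (And phi psi) => a; rewrite sat_And Hphi Hpsi.
Qed.

Lemma traced_ext V (X Y : (V -> M) -> Prop) :
  (forall a, X a <-> Y a) -> traced X -> traced Y.
Proof. by move=> XY [phi Hphi]; exists phi => a; rewrite Hphi XY. Qed.

Lemma traced_or V (X Y : (V -> M) -> Prop) :
  traced X -> traced Y -> traced (fun a => X a \/ Y a).
Proof.
move=> /traced_not HX /traced_not HY.
apply: traced_ext (traced_not (traced_and HX HY)) => a.
by rewrite not_andP !notK.
Qed.

(** A parameter b of M is replaced by the coordinates of [tau b], which are parameters of N. *)
Lemma traced_subst V W (g : W -> V + M) (X : (W -> M) -> Prop) :
  traced X -> traced (fun a : V -> M => X (sum_fun a id \o g)).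
Proof.
move=> [phi Hphi].
exists (fmap phi (fun x => match x with
  | inl wj => match g wj.1 with
              | inl v => inl (v, wj.2)
              | inr b => inr (tau b wj.2)
              end
  | inr c => inr c
  end)) => a.
rewrite sat_fmap -Hphi; apply: sat_ext => -[[w j]|c] //=.
by case: (g w).
Qed.

(* A set saturated under finitely many traced relations is a Boolean
   combination of them; the induction splits along one of them. *)
Lemma traced_saturated V (K : eqType) (Theta : K -> (V -> M) -> Prop) (s : seq K)
  (X : (V -> M) -> Prop) :
  (forall k, traced (Theta k)) ->
  (forall v w, (forall k, k \in s -> Theta k v <-> Theta k w) -> X v -> X w) ->
  traced X.
Proof.
move=> HTheta; elim: s X => [|k s IH] X HX.
  have [[v Xv]|nX] := EM (exists v, X v); last first.
    by exists (Bot _ _) => a; split=> // Xa; apply: nX; exists a.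
  by exists (Neg (Bot _ _)) => a; rewrite sat_Neg; split=> [_|_ //]; exact: (HX v).
pose sat_of (D : (V -> M) -> Prop) v := exists w,
  [/\ X w, D w & forall l, l \in s -> Theta l w <-> Theta l v].
have tr D : traced (sat_of D).
  apply: IH => v w vw [u [Xu Du uv]]; exists u; split=> // l ls.
  by rewrite uv // vw.
apply: (@traced_ext _ (fun v => (sat_of (Theta k) v /\ Theta k v) \/
    (sat_of (fun v => ~ Theta k v) v /\ ~ Theta k v))).
  move=> v; split=> [[[[w [Xw kw wv]] kv]|[[w [Xw kw wv]] kv]]|Xv].
  - by apply: HX Xw => l; rewrite in_cons => /orP[/eqP ->|/wv].
  - by apply: HX Xw => l; rewrite in_cons => /orP[/eqP ->|/wv].
  by have [kv|kv] := EM (Theta k v); [left|right]; split=> //; exists v.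
by apply: traced_or; apply: traced_and => //; exact: traced_not.
Qed.

(** Tuples that agree on the finitely many [Theta] are matched by a member of F and so satisfy the
    same formulas. Every definable set is thus saturated under traced relations, hence a Boolean
    combination of them. *)
Lemma trace_criterion (F : (M -> M -> Prop) -> Prop) :
  injective tau -> back_and_forth F ->
  (forall V : finType, exists (K : finType) (Theta : K -> (V -> M) -> Prop),
    (forall k, traced (Theta k)) /\
    forall v w, (forall k, Theta k v <-> Theta k w) ->
      exists R, F R /\ forall x, R (v x) (w x)) ->
  str_trace_defines N M.
Proof.
move=> tau_inj HF HTheta.
exists #|J|, (fun m j => tau m (enum_val j)); split.
  move=> x y /funeqP E; apply: tau_inj; apply: funext => j.
  by have := E (enum_rank j); rewrite enum_rankK.
move=> m X [phi ->{X}].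
(* The parameters of [phi] are treated as further variables of [psi]; [traced_subst] turns them back
   into parameters at the end. *)
have [W [g [psi Hpsi]]] := finite_support phi.
have [K [Theta [Htr HR]]] := HTheta W.
have [|chi Hchi] := @traced_saturated W K Theta (enum K) (fun v => sat v psi) Htr.
  move=> v w vw; have [|R [FR Rvw]] := HR v w; last by rewrite (bf_sat HF psi FR Rvw).
  by move=> k; apply: vw; rewrite mem_enum.
have [chi' Hchi'] := @traced_subst _ _ g _ (ex_intro _ chi Hchi).
exists [set b : 'I_m * 'I_#|J| -> N | sat (fun x => match x with
  | inl ij => b (ij.1, enum_rank ij.2) | inr c => c end) chi']; split.
  exists (fmap chi' (fun x => match x with
    | inl ij => inl (ij.1, enum_rank ij.2) | inr c => inr c end)).
  apply/seteqP; split=> b /=; rewrite sat_fmap.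
    by congr sat; apply: funext => -[].
  by congr sat; apply: funext => -[].
apply/seteqP; split=> a /=.
  move=> H; have : sat (sum_fun a id) phi.
    by move: H; congr sat; apply: funext => -[].
  rewrite Hpsi -Hchi'; congr sat; apply: funext => -[[i j]|//] /=.
  by rewrite enum_rankK.
move=> H; have : sat (tau_val a) chi'.
  move: H; congr sat; apply: funext => -[[i j]|//] /=.
  by rewrite enum_rankK.
by rewrite Hchi' -Hpsi; congr sat; apply: funext => -[].
Qed.

End TraceCriterion.

Lemma str_trace_defines_isomorphism L1 L2 (N : structure L1) (M M' : structure L2)
  (h : M -> M') : isomorphism h -> str_trace_defines N M -> str_trace_defines N M'.
Proof.
move=> Hh; have [[g hK gK] _ _] := Hh; move=> [n [tau [tau_inj Htau]]].
exists n, (tau \o g); split; first exact: inj_comp tau_inj (can_inj gK).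
move=> m X [phi ->{X}].
pose X := [set a : 'I_m -> M | sat (fun x => match x with
  | inl i => h (a i) | inr b => b end) phi].
have [|Y [defY EY]] := Htau m X.
  exists (fmap phi (fun x => match x with inl i => inl i | inr b => inr (g b) end)).
  apply/seteqP; split=> a /=; rewrite sat_fmap (sat_isomorphism _ _ Hh).
    by congr sat; apply: funext => -[//|b] /=; rewrite gK.
  by congr sat; apply: funext => -[//|b] /=; rewrite gK.
exists Y; split=> //; apply/seteqP; split=> a /=.
  move=> H; suff : X (g \o a) by rewrite EY.
  by move: H; rewrite /X /=; congr sat; apply: funext => -[i|//] /=; rewrite gK.
move=> H; have : X (g \o a) by rewrite EY.
by rewrite /X /=; congr sat; apply: funext => -[i|//] /=; rewrite gK.
Qed.

(** * Partial isomorphisms of graphs, unions, vector spaces and symplectic spaces *)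

Section Graphs.

(** The random graph without countability, which is what all models of [Hyp2] retain. *)
Definition saturated_graph (V : Type) (E : V -> V -> Prop) : Prop :=
  [/\ forall x, ~ E x x,
      forall x y, E x y -> E y x &
      forall A B : set V, finite_set A -> finite_set B -> A `&` B = set0 ->
        exists v, [/\ ~ (A `|` B) v, forall a, A a -> E v a &
                      forall b, B b -> ~ E v b]].

Definition graph_piso (V W : Type) (E : V -> V -> Prop) (E' : W -> W -> Prop)
    (R : V -> W -> Prop) : Prop :=
  [/\ finite_set [set xy | R xy.1 xy.2],
      forall a b a' b', R a b -> R a' b' -> a = a' <-> b = b' &
      forall a b a' b', R a b -> R a' b' -> E a a' <-> E' b b'].

Lemma graph_piso_sym V W E E' (R : V -> W -> Prop) :
  graph_piso E E' R -> graph_piso E' E (fun y x => R x y).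
Proof.
move=> [fin inj RE]; split.
- apply: sub_finite_set (finite_image (fun xy : V * W => (xy.2, xy.1)) fin).
  by move=> [y x] /= Rxy; exists (x, y).
- by move=> a b a' b' Rab Rab'; have := inj _ _ _ _ Rab Rab' => ->.
- by move=> a b a' b' Rab Rab'; have := RE _ _ _ _ Rab Rab' => ->.
Qed.

Lemma graph_piso_forth V W E E' (R : V -> W -> Prop) a :
  saturated_graph E -> saturated_graph E' -> graph_piso E E' R ->
  exists R' b, [/\ graph_piso E E' R', (forall x y, R x y -> R' x y) & R' a b].
Proof.
move=> [irr sym _] [irr' sym' ext] HR; have [fin inj RE] := HR.
have [[b Rab]|nR] := EM (exists b, R a b); first by exists R, b.
have finS (A : set W) : (forall y, A y -> exists x, R x y) -> finite_set A.
  move=> HA; apply: sub_finite_set (finite_image snd fin) => y /HA[x Rxy].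
  by exists (x, y).
have [|||b [nb bA bB]] := ext [set y | exists x, R x y /\ E a x]
    [set y | exists x, R x y /\ ~ E a x].
- by apply: finS => y [x [Rxy _]]; exists x.
- by apply: finS => y [x [Rxy _]]; exists x.
- apply/seteqP; split=> y //= -[[x [Rxy Eax]] [x' [Rx'y]]].
  by have [_ <-] := inj _ _ _ _ Rxy Rx'y.
have nRb x : ~ R x b.
  move=> Rxb; apply: nb; have [Eax|Eax] := EM (E a x); [left|right]; by exists x.
have Eb x y : R x y -> E a x <-> E' b y.
  move=> Rxy; split=> [Eax|]; first by apply: bA; exists x.
  by apply: contraPP => nE; apply: bB; exists x.
exists (fun x y => R x y \/ x = a /\ y = b), b; split; [|by left|by right].
split.
- apply: (@sub_finite_set _ _ ([set xy | R xy.1 xy.2] `|` [set (a, b)])).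
    by move=> [x y] /= [|[-> ->]]; [left|right].
  by rewrite finite_setU; split.
- move=> x y x' y' [Rxy|[-> ->]] [Rxy'|[-> ->]] //; first exact: inj.
    split=> E0; first by case: nR; exists y; rewrite -E0.
    by case: (nRb x); rewrite -E0.
  split=> E0; first by case: nR; exists y'; rewrite E0.
  by case: (nRb x'); rewrite E0.
- move=> x y x' y' [Rxy|[-> ->]] [Rxy'|[-> ->]]; first exact: RE.
  + by split=> /[dup] ?; [move=> /sym/(Eb _ _ Rxy)/sym'|move=> /sym'/(Eb _ _ Rxy)/sym].
  + exact: Eb.
  + by split=> [/irr|/irr'].
Qed.

Lemma graph_back_and_forth V W V0 W0 E E' :
  saturated_graph E -> saturated_graph E' ->
  @back_and_forth _ (@graph_structure V V0 E) (@graph_structure W W0 E') (graph_piso E E').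
Proof.
move=> HE HE'; split.
- by move=> R a b a' b' [_ inj _]; exact: inj.
- by move=> R [].
- by move=> R r a b [_ _ RE] Rab; exact: RE.
- by move=> R a HR; exact: graph_piso_forth.
- move=> R b /graph_piso_sym HR.
  have [R' [a [HR' RR' R'ab]]] := graph_piso_forth b HE' HE HR.
  by exists (fun x y => R' y x), a; split=> // [|x y /RR']; first exact: graph_piso_sym.
Qed.

(** The empty relation is a finite partial isomorphism, and a sentence has no free variables to
    match. *)
Lemma saturated_graph_elementary V W V0 W0 E E' (phi : sentence graph_lang) :
  saturated_graph E -> saturated_graph E' ->
  holds (@graph_structure V V0 E) phi <-> holds (@graph_structure W W0 E') phi.
Proof.
move=> HE HE'.
apply: (bf_sat (graph_back_and_forth V0 W0 HE HE') phi (R := fun _ _ => False)) => //.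
Qed.

End Graphs.

Section DisjointUnionBackAndForth.
Variables L1 L2 : language.

Definition rel_sum (M1 N1 M2 N2 : Type) (R1 : M1 -> N1 -> Prop) (R2 : M2 -> N2 -> Prop)
    (x : M1 + M2) (y : N1 + N2) : Prop :=
  match x, y with
  | inl x, inl y => R1 x y
  | inr x, inr y => R2 x y
  | _, _ => False
  end.

Lemma rel_sum_inl M1 N1 M2 N2 (R1 : M1 -> N1 -> Prop) (R2 : M2 -> N2 -> Prop) x z :
  rel_sum R1 R2 (inl x) z -> exists y, z = inl y /\ R1 x y.
Proof. by case: z => // y Rxy; exists y. Qed.

Lemma rel_sum_inr M1 N1 M2 N2 (R1 : M1 -> N1 -> Prop) (R2 : M2 -> N2 -> Prop) x z :
  rel_sum R1 R2 (inr x) z -> exists y, z = inr y /\ R2 x y.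
Proof. by case: z => // y Rxy; exists y. Qed.

(** The half of a partial isomorphism that carries truth from left to right; applied to the converse
    relation too, it yields equivalences. Single-valuedness is what preserves the graphs of
    functions. *)
Definition partial_hom (L : language) (M N : structure L) (R : M -> N -> Prop) :=
  [/\ forall a b b', R a b -> R a b' -> b = b',
      forall f a b, (forall i, R (a i) (b i)) -> R (fint (f := f) a) (fint (f := f) b) &
      forall r a b, (forall i, R (a i) (b i)) -> rint (r := r) a -> rint (r := r) b].

Lemma dunion_rint_hom (M1 N1 : structure L1) (M2 N2 : structure L2) R1 R2 r
  (a : 'I_(rar r) -> dunion M1 M2) (b : 'I_(rar r) -> dunion N1 N2) :
  partial_hom R1 -> partial_hom R2 -> (forall i, rel_sum R1 R2 (a i) (b i)) ->
  rint a -> rint b.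
Proof.
move=> [inj1 f1 r1] [inj2 f2 r2].
case: r a b => [||f|f|r|r] a b Rab /=.
- move=> [x Ex]; have := Rab ord0; rewrite Ex.
  by move=> /(@rel_sum_inl _ _ _ _ R1 R2)[y [Ey _]]; exists y.
- move=> [x Ex]; have := Rab ord0; rewrite Ex.
  by move=> /(@rel_sum_inr _ _ _ _ R1 R2)[y [Ey _]]; exists y.
- move=> [a' [E0 Ea]].
  have /choice[b' Hb'] : forall i, exists y, b (lift ord0 i) = inl y /\ R1 (a' i) y.
    by move=> i; apply: (@rel_sum_inl _ _ _ _ R1 R2); rewrite -Ea; exact: Rab.
  exists b'; split=> [|i]; last by case: (Hb' i).
  have := Rab ord0; rewrite E0 => /(@rel_sum_inl _ _ _ _ R1 R2)[y [-> Ry]]; congr inl.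
  by apply: inj1 Ry _; apply: f1 => i; case: (Hb' i).
- move=> [a' [E0 Ea]].
  have /choice[b' Hb'] : forall i, exists y, b (lift ord0 i) = inr y /\ R2 (a' i) y.
    by move=> i; apply: (@rel_sum_inr _ _ _ _ R1 R2); rewrite -Ea; exact: Rab.
  exists b'; split=> [|i]; last by case: (Hb' i).
  have := Rab ord0; rewrite E0 => /(@rel_sum_inr _ _ _ _ R1 R2)[y [-> Ry]]; congr inr.
  by apply: inj2 Ry _; apply: f2 => i; case: (Hb' i).
- move=> [a' [ra Ea]].
  have /choice[b' Hb'] : forall i, exists y, b i = inl y /\ R1 (a' i) y.
    by move=> i; apply: (@rel_sum_inl _ _ _ _ R1 R2); rewrite -Ea; exact: Rab.
  exists b'; split=> [|i]; last by case: (Hb' i).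
  by apply: r1 ra => i; case: (Hb' i).
- move=> [a' [ra Ea]].
  have /choice[b' Hb'] : forall i, exists y, b i = inr y /\ R2 (a' i) y.
    by move=> i; apply: (@rel_sum_inr _ _ _ _ R1 R2); rewrite -Ea; exact: Rab.
  exists b'; split=> [|i]; last by case: (Hb' i).
  by apply: r2 ra => i; case: (Hb' i).
Qed.

Lemma bf_partial_hom L (M N : structure L) (F : (M -> N -> Prop) -> Prop) R :
  back_and_forth F -> F R -> partial_hom R /\ partial_hom (fun y x => R x y).
Proof.
move=> HF FR; split; split=> [a b b' Rab Rab'|f a b|r a b Rab].
- exact: (bf_inj HF FR Rab Rab').1.
- exact: (bf_fint HF).
- exact: (bf_rint HF FR Rab).1.
- exact: (bf_inj HF FR Rab Rab').2.
- exact: (bf_fint HF).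
- exact: (bf_rint HF FR Rab).2.
Qed.

Variables (M1 N1 : structure L1) (M2 N2 : structure L2).
Variables (F1 : (M1 -> N1 -> Prop) -> Prop) (F2 : (M2 -> N2 -> Prop) -> Prop).

Definition dunion_family (R : dunion M1 M2 -> dunion N1 N2 -> Prop) :=
  exists R1 R2, [/\ F1 R1, F2 R2 & R = rel_sum R1 R2].

Hypotheses (H1 : back_and_forth F1) (H2 : back_and_forth F2).

Lemma dunion_back_and_forth : back_and_forth dunion_family.
Proof.
split.
- move=> _ a b a' b' [R1 [R2 [FR1 FR2 ->]]].
  case: a => a; case: b => b // Rab; case: a' => a'; case: b' => b' // Rab'.
    have E := bf_inj H1 FR1 Rab Rab'.
    by split=> -[/E ->].
  have E := bf_inj H2 FR2 Rab Rab'.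
  by split=> -[/E ->].
- by move=> R [].
- move=> _ r a b [R1 [R2 [FR1 FR2 ->]]] Rab.
  have [h1 h1'] := bf_partial_hom H1 FR1; have [h2 h2'] := bf_partial_hom H2 FR2.
  split; first exact: dunion_rint_hom Rab.
  apply: dunion_rint_hom h1' h2' _ => i.
  by have := Rab i; case: (a i) => x; case: (b i).
- move=> _ [a|a] [R1 [R2 [FR1 FR2 ->]]].
    have [R' [b [FR' RR' R'ab]]] := bf_forth H1 a FR1.
    exists (rel_sum R' R2), (inl b); split=> //; first by exists R', R2.
    by move=> [x|x] [y|y] //=; exact: RR'.
  have [R' [b [FR' RR' R'ab]]] := bf_forth H2 a FR2.
  exists (rel_sum R1 R'), (inr b); split=> //; first by exists R1, R'.
  by move=> [x|x] [y|y] //=; exact: RR'.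
- move=> _ [b|b] [R1 [R2 [FR1 FR2 ->]]].
    have [R' [a [FR' RR' R'ab]]] := bf_back H1 b FR1.
    exists (rel_sum R' R2), (inl a); split=> //; first by exists R', R2.
    by move=> [x|x] [y|y] //=; exact: RR'.
  have [R' [a [FR' RR' R'ab]]] := bf_back H2 b FR2.
  exists (rel_sum R1 R'), (inr a); split=> //; first by exists R1, R'.
  by move=> [x|x] [y|y] //=; exact: RR'.
Qed.

End DisjointUnionBackAndForth.

Section LinearPartialIsomorphisms.
Local Open Scope ring_scope.
Import GRing.Theory.
Variable F : finFieldType.

(** R is a finite subspace of V x W meeting both factors trivially, that is, the graph of an
    isomorphism between finite subspaces. *)
Definition linear_piso (V W : lmodType F) (R : V -> W -> Prop) : Prop :=
  [/\ finite_set [set xy | R xy.1 xy.2], R 0 0,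
      forall k x y x' y', R x y -> R x' y' -> R (k *: x + x') (k *: y + y'),
      forall y, R 0 y -> y = 0 & forall x, R x 0 -> x = 0].

Section Theory.
Variables (V W : lmodType F) (R : V -> W -> Prop).
Hypothesis HR : linear_piso R.

Lemma lpisoZ k x y : R x y -> R (k *: x) (k *: y).
Proof.
by move=> Rxy; case: HR => _ R0 Rl _ _; have := Rl k _ _ _ _ Rxy R0; rewrite !addr0.
Qed.

Lemma lpisoD x y x' y' : R x y -> R x' y' -> R (x + x') (y + y').
Proof.
by move=> Rxy Rxy'; case: HR => _ _ Rl _ _; have := Rl 1 _ _ _ _ Rxy Rxy'; rewrite !scale1r.
Qed.

Lemma lpisoN x y : R x y -> R (- x) (- y).
Proof. by move=> /(lpisoZ (-1)); rewrite !scaleN1r. Qed.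

Lemma lpisoB x y x' y' : R x y -> R x' y' -> R (x - x') (y - y').
Proof. by move=> Rxy /lpisoN; exact: lpisoD. Qed.

Lemma lpiso_inj x y x' y' : R x y -> R x' y' -> x = x' <-> y = y'.
Proof.
move=> Rxy /(lpisoB Rxy) Rd; case: HR => _ _ _ inj1 inj2.
split=> E; apply/eqP; rewrite -subr_eq0; apply/eqP.
  by apply: inj1; rewrite -[0](subrr x) {2}E.
by apply: inj2; rewrite -[0](subrr y) {2}E.
Qed.

Lemma lpiso_sym : linear_piso (fun y x => R x y).
Proof.
case: HR => fin R0 Rl inj1 inj2; split=> //.
  apply: sub_finite_set (finite_image (fun xy : V * W => (xy.2, xy.1)) fin).
  by move=> [y x] /= Rxy; exists (x, y).
by move=> k x y x' y'; exact: Rl.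
Qed.

Lemma lpiso_finite_image : finite_set [set y | exists x, R x y].
Proof.
case: HR => fin _ _ _ _.
apply: sub_finite_set (finite_image snd fin) => y [x Rxy].
by exists (x, y).
Qed.

Variables (a : V) (b : W).

(** The sum of R and the line through (a, b) in V x W. *)
Definition extend (x : V) (y : W) : Prop :=
  exists k x' y', [/\ R x' y', x = k *: a + x' & y = k *: b + y'].

Lemma sub_extend x y : R x y -> extend x y.
Proof. by move=> Rxy; exists 0, x, y; rewrite !scale0r !add0r. Qed.

Lemma extend_new : extend a b.
Proof. by case: HR => _ R0 _ _ _; exists 1, 0, 0; rewrite !scale1r !addr0. Qed.

Hypotheses (nRa : forall y, ~ R a y) (nRb : forall x, ~ R x b).

Lemma extend_linear_piso : linear_piso extend.
Proof.
have [fin R0 Rl inj1 inj2] := HR; split.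
- have := finite_setX (@finite_finset F setT) fin.
  move=> /(finite_image (fun kxy => (kxy.1 *: a + kxy.2.1, kxy.1 *: b + kxy.2.2))).
  apply: sub_finite_set => -[_ _] /= [k [x [y [Rxy -> ->]]]].
  by exists (k, (x, y)).
- by exact: sub_extend.
- move=> k _ _ _ _ [l [x [y [Rxy -> ->]]]] [l' [x' [y' [Rxy' -> ->]]]].
  exists (k * l + l'), (k *: x + x'), (k *: y + y'); split; first exact: Rl.
    by rewrite scalerDr scalerA scalerDl addrACA.
  by rewrite scalerDr scalerA scalerDl addrACA.
- move=> _ [k [x [y [Rxy E ->]]]]; have [k0|k0] := eqVneq k 0.
    move: E Rxy; rewrite k0 !scale0r !add0r => <-; exact: inj1.
  case: (nRa (y := k^-1 *: - y)).
  have -> : a = k^-1 *: - x.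
    by apply: (scalerI k0); rewrite scalerA divff // scale1r; apply/eqP; rewrite -addr_eq0 -E.
  by apply: lpisoZ; exact: lpisoN.
- move=> _ [k [x [y [Rxy -> E]]]]; have [k0|k0] := eqVneq k 0.
    move: E Rxy; rewrite k0 !scale0r !add0r => <-; exact: inj2.
  case: (nRb (x := k^-1 *: - x)).
  have -> : b = k^-1 *: - y.
    by apply: (scalerI k0); rewrite scalerA divff // scale1r; apply/eqP; rewrite -addr_eq0 -E.
  by apply: lpisoZ; exact: lpisoN.
Qed.

End Theory.

Lemma infinite_escape (T : Type) (A : set T) :
  infinite_set [set: T] -> finite_set A -> exists x, ~ A x.
Proof.
move=> infT finA; apply: contrapT => H; apply: infT.
by apply: sub_finite_set finA => x _; apply: contrapT => nAx; apply: H; exists x.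
Qed.

Lemma linear_piso_forth (V W : lmodType F) (R : V -> W -> Prop) a :
  infinite_set [set: W] -> linear_piso R ->
  exists R' b, [/\ linear_piso R', (forall x y, R x y -> R' x y) & R' a b].
Proof.
move=> infW HR; have [[b Rab]|nR] := EM (exists b, R a b); first by exists R, b.
have [b nRb] := infinite_escape infW (lpiso_finite_image HR).
exists (extend R a b), b; split; [|exact: sub_extend|exact: extend_new].
by apply: extend_linear_piso => // [y Ray|x Rxb]; [apply: nR; exists y|apply: nRb; exists x].
Qed.

Definition span (I : finType) (V : lmodType F) (v : I -> V) (k : {ffun I -> F}) : V :=
  \sum_i k i *: v i.

Lemma spanD (I : finType) (V : lmodType F) (v : I -> V) l k k' :
  l *: span v k + span v k' = span v [ffun i => l * k i + k' i].
Proof.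
rewrite /span scaler_sumr -big_split; apply: eq_bigr => i _.
by rewrite ffunE scalerDl scalerA.
Qed.

Lemma span0 (I : finType) (V : lmodType F) (v : I -> V) : span v [ffun=> 0] = 0.
Proof. by rewrite /span big1 // => i _; rewrite ffunE scale0r. Qed.

Lemma span1 (I : finType) (V : lmodType F) (v : I -> V) i :
  span v [ffun j => (j == i)%:R] = v i.
Proof.
rewrite /span (bigD1 i) //= ffunE eqxx scale1r big1 ?addr0 // => j /negPf ji.
by rewrite ffunE ji scale0r.
Qed.

Lemma span_linear_piso (I : finType) (V W : lmodType F) (v : I -> V) (w : I -> W) :
  (forall k, span v k = 0 <-> span w k = 0) ->
  linear_piso (fun x y => exists k, x = span v k /\ y = span w k).
Proof.
move=> H; split.
- have := finite_image (fun k => (span v k, span w k)) (@finite_finset {ffun I -> F} setT).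
  apply: sub_finite_set => -[_ _] /= [k [-> ->]]; by exists k.
- by exists [ffun=> 0]; rewrite !span0.
- move=> l _ _ _ _ [k [-> ->]] [k' [-> ->]].
  by exists [ffun i => l * k i + k' i]; rewrite !spanD.
- by move=> y [k [/esym/H E ->]].
- by move=> x [k [-> /esym/H E]].
Qed.

End LinearPartialIsomorphisms.

(** * Alternating forms with a one-generator radical *)

Section SymplecticPartialIsomorphisms.
Local Open Scope ring_scope.
Import GRing.Theory.
Variables (F : finFieldType) (V : lmodType F) (omega : V -> V -> F) (c : V).

(** The radical of the form is exactly the set of multiples of c. In the application it is the
    center of the group. *)
Record symplectic := Symplectic {
  omegaDl : forall k x y z, omega (k *: x + y) z = k * omega x z + omega y z;
  omegaC : forall x y, omega x y = - omega y x;
  omega_alt : forall x, omega x x = 0;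
  omega_c : forall x, omega c x = 0;
  omega_radical : forall x, (forall y, omega x y = 0) -> exists k, x = k *: c;
  symplectic_infinite : infinite_set [set: V] }.

Definition symplectic_piso (R : V -> V -> Prop) : Prop :=
  [/\ linear_piso R, R c c &
      forall x y x' y', R x y -> R x' y' -> omega x x' = omega y y'].

Lemma symplectic_piso_sym R : symplectic_piso R -> symplectic_piso (fun y x => R x y).
Proof.
move=> [HR Rc Rom]; split=> //; first exact: lpiso_sym.
by move=> x y x' y' Rxy Rxy'; rewrite (Rom _ _ _ _ Rxy Rxy').
Qed.

Hypothesis H : symplectic.

Lemma omegaDr k x y z : omega z (k *: x + y) = k * omega z x + omega z y.
Proof. by rewrite omegaC // (omegaDl H) opprD -mulrN -!(omegaC H). Qed.

Lemma omega0l z : omega 0 z = 0.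
Proof. by have := omegaDl H (-1) 0 0 z; rewrite scaler0 add0r mulN1r addNr. Qed.

Lemma omega0r z : omega z 0 = 0.
Proof. by rewrite (omegaC H) omega0l oppr0. Qed.

Lemma omegaBr x y z : omega z (x - y) = omega z x - omega z y.
Proof. by rewrite -scaleN1r addrC omegaDr mulN1r addrC. Qed.

(* Duality: a vector whose orthogonal contains l^perp lies, modulo the radical,
   in the span of l. *)
Lemma double_orthogonal (l : seq V) (B : V -> Prop) :
  B 0 -> (forall k x y, B x -> B y -> B (k *: x + y)) ->
  (forall z, z \in l -> B z) -> forall y,
  (exists v, (forall z, z \in l -> omega v z = 0) /\ omega v y <> 0) \/
  (exists z, B z /\ forall v, omega v y = omega v z).
Proof.
move=> B0 Blin; elim: l => [|z l IH] Bl y.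
  have [[v Hv]|nv] := EM (exists v, omega v y <> 0); first by left; exists v.
  right; exists 0; split=> // v; rewrite omega0r.
  by apply: contrapT => Hv; apply: nv; exists v.
have {}IH := IH (fun x xl => Bl x (@mem_behead _ (z :: l) x xl)).
have [[v0 [v0l v0y]]|[x [Bx Hx]]] := IH y; last by right; exists x.
have [v0z|/eqP v0z] := EM (omega v0 z = 0).
  by left; exists v0; split=> // x; rewrite in_cons => /orP[/eqP ->|/v0l].
(* With this d, [v0] is orthogonal to y - d z. A vector can therefore be made orthogonal to z by
   adding a multiple of [v0], without changing its value at y - d z. *)
pose d := omega v0 y / omega v0 z.
have [[v1 [v1l v1y]]|[x [Bx Hx]]] := IH (- d *: z + y).
  left; exists (- (omega v1 z / omega v0 z) *: v0 + v1); split=> [x|].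
    rewrite in_cons => /orP[/eqP ->|xl]; rewrite (omegaDl H).
      by rewrite mulNr divfK // addNr.
    by rewrite (v0l x) // (v1l x) // mulr0 addr0.
  move: v1y; rewrite omegaDr (omegaDl H) !mulNr; congr (_ + _ <> _).
  by congr (- _); rewrite /d mulrAC [RHS]mulrAC [omega v0 y * _]mulrC.
right; exists (d *: z + x); split=> [|v].
  by apply: Blin => //; apply: Bl; exact: mem_head.
by rewrite omegaDr -Hx omegaDr mulNr addrA addrN add0r.
Qed.

(** A new pair (x, y) leaves two cases. Either some vector orthogonal to the earlier second entries
    detects y and corrects b; or y agrees modulo c with some z where the value is already right, and
    then, as R fixes c, x agrees with the preimage of z in the same way. *)
Lemma omega_prescribed R a (l : seq (V * V)) :
  symplectic_piso R -> (forall xy, xy \in l -> R xy.1 xy.2) ->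
  exists b, forall xy, xy \in l -> omega b xy.2 = omega a xy.1.
Proof.
move=> [HR Rc Rom]; elim: l => [|[x y] l IH] Rl; first by exists 0.
have [b0 Hb0] := IH (fun xy xyl => Rl xy (@mem_behead _ ((x, y) :: l) xy xyl)).
have [_ R0 Rlin _ _] := HR.
have [||z||] := @double_orthogonal (map snd l)
    (fun z => exists x', R x' z /\ omega b0 z = omega a x') _ _ _ y.
- by exists 0; rewrite !omega0r.
- move=> k z z' [u [Ruz E]] [u' [Ruz' E']]; exists (k *: u + u').
  split; first exact: Rlin.
  by rewrite !omegaDr E E'.
- move=> /mapP[[x' z'] xzl ->]; exists x'; split; last exact: Hb0 xzl.
  by have := Rl _ (@mem_behead _ ((x, y) :: l) (x', z') xzl).
- move=> [v [vl vy]]; exists ((omega a x - omega b0 y) / omega v y *: v + b0) => xy.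
  rewrite in_cons (omegaDl H) => /orP[/eqP -> /=|xyl].
    by rewrite divfK ?subrK //; exact/eqP.
  by rewrite (vl _ (map_f snd xyl)) mulr0 add0r; exact: Hb0.
- move=> [z [[x' [Rxz E]] Hz]].
  have [k Ek] : exists k, y - z = k *: c.
    by apply: (omega_radical H) => v; rewrite (omegaC H) omegaBr Hz subrr oppr0.
  have Rxy : R (k *: c + x') y by rewrite -(subrK z y) Ek; exact: Rlin.
  have Rxy' : R x y by exact: Rl _ (mem_head _ _).
  have Ex : x = k *: c + x' by apply/(lpiso_inj HR Rxy' Rxy).
  exists b0 => xy; rewrite in_cons => /orP[/eqP -> /=|]; last exact: Hb0.
  by rewrite Hz E Ex omegaDr (omegaC H _ c) (omega_c H) oppr0 mulr0 add0r.
Qed.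

(** Each further condition divides the space into finitely many translates, since the field is
    finite. *)
Lemma infinite_orthogonal (l : seq V) :
  infinite_set [set v | forall z, z \in l -> omega v z = 0].
Proof.
elim: l => [|z l IH].
  move=> fin; apply: (symplectic_infinite H).
  by apply: sub_finite_set fin.
have [[v0 [v0l v0z]]|nv] :=
    EM (exists v, (forall x, x \in l -> omega v x = 0) /\ omega v z <> 0); last first.
  move=> fin; apply: IH; apply: sub_finite_set fin => v vl x.
  rewrite in_cons => /orP[/eqP ->|/vl//].
  by apply: contrapT => vz; apply: nv; exists v.
move=> fin; apply: IH.
have := finite_image (fun kv => kv.1 *: v0 + kv.2) (finite_setX (@finite_finset F setT) fin).
apply: sub_finite_set => v vl /=.
pose k := omega v z / omega v0 z.
exists (k, - k *: v0 + v); last by rewrite /= scaleNr addrA addrN add0r.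
split=> //= x; rewrite in_cons (omegaDl H) => /orP[/eqP ->|xl].
  by rewrite mulNr divfK ?addNr //; exact/eqP.
by rewrite (v0l x) // (vl x) // mulr0 addr0.
Qed.

Lemma symplectic_piso_forth R a : symplectic_piso R ->
  exists R' b, [/\ symplectic_piso R', (forall x y, R x y -> R' x y) & R' a b].
Proof.
move=> HR; have [[b Rab]|nR] := EM (exists b, R a b); first by exists R, b.
have [HRl Rc Rom] := HR; have [fin _ _ _ _] := HRl.
have [l El] := (finite_seqP _).1 fin.
have inl xy : (xy \in l) <-> R xy.1 xy.2.
  by have /seteqP[H1 H2] := El; split=> [/H2|/H1].
have [b0 Hb0] := omega_prescribed a HR (fun xy => (inl xy).1).
(* The image of b must also lie outside the finite range of R. Adding a vector orthogonal to that
   range keeps the prescribed values, and infinitely many such vectors are available. *)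
have [u [ul nu]] : exists u, (forall z, z \in map snd l -> omega u z = 0) /\
    ~ exists x, R x (u + b0).
  apply: contrapT => nex; apply: (@infinite_orthogonal (map snd l)).
  apply: sub_finite_set (finite_image (fun y => y - b0) (lpiso_finite_image HRl)) => u ul.
  exists (u + b0); last by rewrite addrK.
  by apply: contrapT => nu; apply: nex; exists u.
pose b := u + b0.
have Hb x y : R x y -> omega a x = omega b y.
  move=> Rxy; rewrite /b -[u]scale1r (omegaDl H) (Hb0 (x, y)); last exact/inl.
  by rewrite (ul _ (map_f snd ((inl (x, y)).2 Rxy))) mulr0 add0r.
exists (extend R a b), b; split; [|exact: sub_extend|exact: extend_new].
split; [|exact: sub_extend|].
  by apply: extend_linear_piso => // [y Ray|x Rxb]; [apply: nR; exists y|apply: nu; exists x].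
move=> _ _ _ _ [k [x [y [Rxy -> ->]]]] [k' [x' [y' [Rxy' -> ->]]]].
rewrite !(omegaDl H) !omegaDr !(omega_alt H) (Rom _ _ _ _ Rxy Rxy') (Hb _ _ Rxy').
by rewrite !(omegaC H _ a) !(omegaC H _ b) (Hb _ _ Rxy).
Qed.

End SymplecticPartialIsomorphisms.

(** * Models of the three theories *)

Lemma structure_eq L (M : structure L) T0 f r :
  (fun g => @fint L M g) = f -> (fun s => @rint L M s) = r ->
  M = @Structure L (carrier M) T0 f r.
Proof. by case: M T0 f r => T T0' f' r' T0 f r /= <- <-; congr Structure. Qed.

Section GraphModels.

Definition edge (M : structure graph_lang) (x y : M) : Prop :=
  rint (s := M) (r := tt) (two x y).

Definition graph_irreflexive (M : structure graph_lang) := forall x : M, ~ edge x x.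

Definition graph_symmetric (M : structure graph_lang) :=
  forall x y : M, edge x y -> edge y x.

Definition graph_extension m n (M : structure graph_lang) :=
  forall (a : 'I_m -> M) (b : 'I_n -> M), (forall i j, a i <> b j) ->
  exists v, (forall i, v <> a i /\ edge v (a i)) /\
            (forall j, v <> b j /\ ~ edge v (b j)).

Lemma exp_edge Idx (S : Idx -> structure graph_lang) V (x y : V) :
  expressible (fun i (v : V -> S i) => edge (v x) (v y)).
Proof. by apply: exp_rel => k; rewrite /two; case: (val k == 0); exact: texp_var. Qed.

Lemma graph_irreflexive_expressible : sentence_expressible graph_irreflexive.
Proof. by apply: exp_all; apply: exp_not; exact: exp_edge. Qed.

Lemma graph_symmetric_expressible : sentence_expressible graph_symmetric.
Proof. by do 2!apply: exp_all; apply: exp_imp; exact: exp_edge. Qed.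

Lemma graph_extension_expressible m n : sentence_expressible (graph_extension m n).
Proof.
apply: exp_block; apply: exp_block; apply: exp_imp.
  apply: exp_fin => i; apply: exp_fin => j; apply: exp_not.
  by apply: exp_eq; exact: texp_var.
apply: exp_ex; apply: exp_and; apply: exp_fin => i; apply: exp_and.
- by apply: exp_not; apply: exp_eq; exact: texp_var.
- exact: exp_edge.
- by apply: exp_not; apply: exp_eq; exact: texp_var.
- by apply: exp_not; exact: exp_edge.
Qed.

Lemma Hyp2_model (M : structure graph_lang) : models M Hyp2 ->
  exists (V : Type) (V0 : inhabited V) (E : V -> V -> Prop),
    saturated_graph E /\ M = graph_structure V0 E.
Proof.
move=> HM.
pose K (N : structure graph_lang) := exists (V : Type) (V0 : inhabited V) E,
  is_random_graph E /\ N = @graph_structure V V0 E.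
have {}HM phi : (forall N, K N -> holds N phi) -> holds M phi.
  by move=> H; apply: HM => V V0 E HE; apply: H; exists V, V0, E.
have irr : graph_irreflexive M.
  apply: expressible_transfer HM; first exact: graph_irreflexive_expressible.
  by move=> _ [V [V0 [E [[_ irr _ _] ->]]]] x; exact: irr.
have sym : graph_symmetric M.
  apply: expressible_transfer HM; first exact: graph_symmetric_expressible.
  by move=> _ [V [V0 [E [[_ _ sym _] ->]]]] x y; exact: sym.
have ext m n : graph_extension m n M.
  apply: expressible_transfer HM; first exact: graph_extension_expressible.
  move=> _ [V [V0 [E [[_ _ _ ext] ->]]]] a b /= ab.
  have [|||v [nv va vb]] := ext (range a) (range b).
  - by apply/finite_set_range; exists m, a.
  - by apply/finite_set_range; exists n, b.
  - by apply/seteqP; split=> // x [[i _ <-] [j _ /esym/ab]].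
  exists v; split=> i.
    by split=> [Ev|]; [apply: nv; left; exists i|apply: va; exists i].
  by split=> [Ev|]; [apply: nv; right; exists i|apply: vb; exists i].
exists M, (carrier_inhabited M), (@edge M); split.
  split=> // _ _ /finite_set_range[m [a ->]] /finite_set_range[n [b ->]] /seteqP[disj _].
  have [i j Eij|v [va vb]] := ext m n a b.
    by apply: (disj (a i)); split; [exists i|exists j].
  exists v; split=> [[[i _ Ei]|[i _ Ei]]|_ [i _ <-]|_ [i _ <-]].
  - by case: (va i); rewrite Ei.
  - by case: (vb i); rewrite Ei.
  - by case: (va i).
  - by case: (vb i).
have Er : (fun r (a : 'I_2 -> M) => rint (s := M) (r := r) a) =
    (fun _ a => edge (a ord0) (a ord_max)).
  by apply: functional_extensionality_dep => -[]; apply: funext => a; rewrite /edge -two_eta.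
have Ef : (fun f => @fint _ M f) = (fun f : void => match f with end).
  by apply: functional_extensionality_dep => -[].
exact: structure_eq.
Qed.

End GraphModels.

Section VectorModels.
Local Open Scope ring_scope.
Import GRing.Theory.
Variable p : nat.
Local Notation L := (vec_lang p).

Section Operations.
Variable M : structure L.
Definition vzero : M := fint (s := M) (f := VZero p) (@no_args M).
Definition vopp (x : M) : M := fint (s := M) (f := VOpp p) (fun=> x).
Definition vadd (x y : M) : M := fint (s := M) (f := VAdd p) (two x y).
Definition vscale (k : 'F_p) (x : M) : M := fint (s := M) (f := VScale k) (fun=> x).
End Operations.

Definition additive_axioms (M : structure L) : Prop :=
  (forall x y z : M, vadd x (vadd y z) = vadd (vadd x y) z) /\
  (forall x y : M, vadd x y = vadd y x) /\
  (forall x : M, vadd (vzero M) x = x) /\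
  (forall x : M, vadd (vopp x) x = vzero M).

Definition scaling_axioms (M : structure L) : Prop :=
  (forall k l (x : M), vscale k (vscale l x) = vscale (k * l) x) /\
  (forall x : M, vscale 1 x = x) /\
  (forall k (x y : M), vscale k (vadd x y) = vadd (vscale k x) (vscale k y)) /\
  (forall k l (x : M), vscale (k + l) x = vadd (vscale k x) (vscale l x)).

Section Terms.
Variables (Idx : Type) (S : Idx -> structure L) (V : Type).

Lemma texp_vzero : texpressible (fun i (v : V -> S i) => vzero (S i)).
Proof. by apply: texp_app => -[]. Qed.

Lemma texp_vopp t : texpressible t -> texpressible (fun i (v : V -> S i) => vopp (t i v)).
Proof. by move=> Ht; apply: texp_app. Qed.

Lemma texp_vadd t u : texpressible t -> texpressible u ->
  texpressible (fun i (v : V -> S i) => vadd (t i v) (u i v)).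
Proof. by move=> Ht Hu; apply: texp_app => k; rewrite /two; case: (val k == 0). Qed.

Lemma texp_vscale a t :
  texpressible t -> texpressible (fun i (v : V -> S i) => vscale a (t i v)).
Proof. by move=> Ht; apply: texp_app. Qed.

End Terms.

Local Ltac express :=
  repeat first [ apply: exp_and | apply: exp_all | apply: exp_fin => ? | apply: exp_eq
               | exact: texp_var | apply: texp_vzero | apply: texp_vadd
               | apply: texp_vopp | apply: texp_vscale ].

Lemma additive_axioms_expressible : sentence_expressible additive_axioms.
Proof. by express. Qed.

Lemma scaling_axioms_expressible : sentence_expressible scaling_axioms.
Proof. by express. Qed.

Lemma Vec_model (M : structure L) : models M (Vec p) ->
  exists V : lmodType 'F_p, infinite_set [set: V] /\ M = vec_structure V.
Proof.
move=> HM.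
pose K (N : structure L) := exists V : lmodType 'F_p,
  infinite_set [set: V] /\ N = vec_structure V.
have {}HM phi : (forall N, K N -> holds N phi) -> holds M phi.
  by move=> H; apply: HM => V infV; apply: H; exists V.
have [vaddA [vaddC [vadd0 vaddN]]] : additive_axioms M.
  apply: expressible_transfer HM; first exact: additive_axioms_expressible.
  move=> _ [V [_ ->]]; do !split.
  - by move=> x y z; exact: addrA.
  - by move=> x y; exact: addrC.
  - by move=> x; exact: add0r.
  - by move=> x; exact: addNr.
have [vscaleA [vscale1 [vscaleDr vscaleDl]]] : scaling_axioms M.
  apply: expressible_transfer HM; first exact: scaling_axioms_expressible.
  move=> _ [V [_ ->]]; do !split.
  - by move=> k l x; exact: scalerA.
  - by move=> x; exact: scale1r.
  - by move=> k x y; exact: scalerDr.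
  - by move=> k l x; exact: scalerDl.
have infM : infinite_set [set: M].
  apply/infinite_structureP => n.
  apply: expressible_transfer HM; first exact: infinite_structure_expressible.
  by move=> _ [V [infV ->]]; exact: (infinite_structureP (vec_structure V)).1.
(* [{classic M}] is the carrier with classical equality and choice, so the structure recovered is
   equal to M and not just isomorphic. *)
pose Z : zmodType := HB.pack_for zmodType {classic M}
  (GRing.isZmodule.Build {classic M} vaddA vaddC vadd0 vaddN).
pose V : lmodType 'F_p := HB.pack_for (lmodType 'F_p) Z
  (GRing.Zmodule_isLmodule.Build 'F_p Z vscaleA vscale1 vscaleDr
    (fun x k l => vscaleDl k l x)).
exists V; split=> //.
have Ef : (fun f => @fint _ M f) = (fun f => @vec_fint p V f).
  apply: functional_extensionality_dep => -[|||k]; apply: funext => a /=.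
  - by rewrite (no_args_eta a).
  - by rewrite {1}(one_eta a).
  - by rewrite {1}(two_eta a).
  - by rewrite {1}(one_eta a).
have Er : (fun r => @rint _ M r) = (fun r : void => match r with end).
  by apply: functional_extensionality_dep => -[].
exact: structure_eq.
Qed.

End VectorModels.

Section GroupModels.
Local Open Scope group_scope.
Variable p : nat.
Hypothesis p_prime : prime p.
Local Notation L := group_lang.

(** A form of the hypotheses that sentences, or a scheme of them for infinity, can state: single
    commutators are quantified over in place of the subgroup they generate, and the center is listed
    as p powers. *)
Record extraspecial_like (G : groupType) : Prop := ExtraspecialLike {
  es_infinite : infinite_set [set: G];
  es_expg : forall a : G, a ^+ p = 1;
  es_center : exists c : G, [/\ c <> 1, center_set c &
    forall z, center_set z -> exists k : 'I_p, z = c ^+ k];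
  es_commg : forall x y : G, center_set [~ x, y] }.

Lemma extraspecial_is_like (G : groupType) :
  infinite_set [set: G] -> is_extraspecial p G -> extraspecial_like G.
Proof.
move=> infG [expG ZG [z Zz] cardZ]; split=> //.
- exists z; have zZ : center_set z by rewrite Zz; exists 1%N.
  split=> // [z1|y]; last first.
    rewrite Zz => -[k _ <-]; exists (Ordinal (ltn_pmod k (prime_gt0 p_prime))) => /=.
    by rewrite {1}(divn_eq k p) expgnDr mulnC expgnA expG expg1n mul1g.
  (* Were z trivial, the center would have one element instead of p. *)
  have Z1 : @center_set G = [set 1].
    by rewrite Zz; apply/seteqP; split=> [_ [k _ <-]|_ ->] /=; [rewrite z1 expg1n|exists 0%N].
  have /card_eq_II E : (`I_1 #= `I_p)%card.
    by apply: card_eq_trans cardZ; rewrite Z1; apply: card_esym; exact: card_set1.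
  by move: p_prime; rewrite -E.
- by move=> x y; rewrite ZG => H [_ HH]; apply: HH; exists x, y.
Qed.

Section Operations.
Variable M : structure L.
Definition gone : M := fint (s := M) (f := GOne) (@no_args M).
Definition ginv (x : M) : M := fint (s := M) (f := GInv) (fun=> x).
Definition gmul (x y : M) : M := fint (s := M) (f := GMul) (two x y).
Definition gexp (x : M) (n : nat) : M := iter n (gmul x) gone.
Definition gcomm (x y : M) : M := gmul (ginv x) (gmul (ginv y) (gmul x y)).
End Operations.

Definition group_axioms (M : structure L) : Prop :=
  (forall x y z : M, gmul x (gmul y z) = gmul (gmul x y) z) /\
  (forall x : M, gmul (gone M) x = x) /\ (forall x : M, gmul x (gone M) = x) /\
  (forall x : M, gmul (ginv x) x = gone M) /\ (forall x : M, gmul x (ginv x) = gone M).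

Definition extraspecial_axioms (M : structure L) : Prop :=
  (forall x : M, gexp x p = gone M) /\
  (exists c : M, (~ c = gone M) /\ (forall x, gmul c x = gmul x c) /\
    forall z, (forall x, gmul z x = gmul x z) -> exists k : 'I_p, z = gexp c k) /\
  (forall x y z : M, gmul (gcomm x y) z = gmul z (gcomm x y)).

Section Terms.
Variables (Idx : Type) (S : Idx -> structure L) (V : Type).

Lemma texp_gone : texpressible (fun i (v : V -> S i) => gone (S i)).
Proof. by apply: texp_app => -[]. Qed.

Lemma texp_ginv t : texpressible t -> texpressible (fun i (v : V -> S i) => ginv (t i v)).
Proof. by move=> Ht; apply: texp_app. Qed.

Lemma texp_gmul t u : texpressible t -> texpressible u ->
  texpressible (fun i (v : V -> S i) => gmul (t i v) (u i v)).
Proof. by move=> Ht Hu; apply: texp_app => k; rewrite /two; case: (val k == 0). Qed.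

Lemma texp_gexp t n :
  texpressible t -> texpressible (fun i (v : V -> S i) => gexp (t i v) n).
Proof. by move=> Ht; elim: n => [|n IH] /=; [exact: texp_gone|exact: texp_gmul]. Qed.

Lemma texp_gcomm t u : texpressible t -> texpressible u ->
  texpressible (fun i (v : V -> S i) => gcomm (t i v) (u i v)).
Proof. by move=> Ht Hu; do ?apply: texp_gmul => //; exact: texp_ginv. Qed.

End Terms.

Local Ltac express :=
  repeat first [ apply: exp_and | apply: exp_all | apply: exp_ex | apply: exp_not
               | apply: exp_finex => ? | apply: exp_eq | apply: exp_imp
               | exact: texp_var | apply: texp_gone | apply: texp_gmul
               | apply: texp_ginv | apply: texp_gexp | apply: texp_gcomm ].

Lemma group_axioms_expressible : sentence_expressible group_axioms.
Proof. by express. Qed.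

Lemma extraspecial_axioms_expressible : sentence_expressible extraspecial_axioms.
Proof. by express. Qed.

Lemma gexpE (G : groupType) (x : group_structure G) n : gexp x n = (x : G) ^+ n.
Proof. by elim: n => //= n IH; rewrite expgS -IH. Qed.

Lemma ES_model (M : structure L) : models M (ES p) ->
  exists G : groupType, extraspecial_like G /\ M = group_structure G.
Proof.
move=> HM.
pose K (N : structure L) := exists G : groupType,
  extraspecial_like G /\ N = group_structure G.
have {}HM phi : (forall N, K N -> holds N phi) -> holds M phi.
  by move=> H; apply: HM => G infG esG; apply: H; exists G; split=> //; exact: extraspecial_is_like.
have [gmulA [gmul1 [gmulr1 [gmulV gmulrV]]]] : group_axioms M.
  apply: expressible_transfer HM; first exact: group_axioms_expressible.
  move=> _ [G [_ ->]]; do !split.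
  - by move=> x y z; exact: mulgA.
  - by move=> x; exact: mul1g.
  - by move=> x; exact: mulg1.
  - by move=> x; exact: mulVg.
  - by move=> x; exact: mulgV.
have [gexpp [gcenter gcommZ]] : extraspecial_axioms M.
  apply: expressible_transfer HM; first exact: extraspecial_axioms_expressible.
  move=> _ [G [[_ expG [c [c1 cZ Zc]] comZ] ->]]; do !split.
  - by move=> x; rewrite gexpE; exact: expG.
  - exists c; split=> //; split=> [x|z /Zc[k Ek]]; first exact: cZ.
    by exists k; rewrite gexpE.
  - by move=> x y z; exact: comZ.
have infM : infinite_set [set: M].
  apply/infinite_structureP => n.
  apply: expressible_transfer HM; first exact: infinite_structure_expressible.
  by move=> _ [G [[infG _ _ _] ->]]; exact: (infinite_structureP (group_structure G)).1.
pose G : groupType := HB.pack_for groupType {classic M}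
  (isGroup.Build {classic M} gmulA gmul1 gmulr1 gmulV gmulrV).
have EM : M = group_structure G.
  apply: structure_eq; apply: functional_extensionality_dep => -[] //; apply: funext => a.
  - by rewrite (no_args_eta a).
  - by rewrite {1}(one_eta a).
  - by rewrite {1}(two_eta a).
have gexpG (x : G) n : x ^+ n = gexp (M := M) x n.
  by elim: n => //= n IH; rewrite expgS IH.
exists G; split=> //; split=> //.
- by move=> x; rewrite gexpG; exact: gexpp.
- have [c [c1 [cZ Zc]]] := gcenter; exists c; split=> // z /Zc[k Ek].
  by exists k; rewrite gexpG.
Qed.

End GroupModels.

(** * Extra-special groups are traced by a vector space and a graph *)

Section BaerCorrespondence.
Import GRing.Theory.
Local Open Scope group_scope.
Variables (p : nat) (G : groupType).
Hypotheses (p_prime : prime p) (p_odd : odd p) (HG : extraspecial_like p G).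

Definition baer_c : G := sval (cid (es_center HG)).
Local Notation c := baer_c.

Lemma baer_c_neq1 : c <> 1.
Proof. by rewrite /c; case: cid => z []. Qed.

Lemma baer_c_central x : commute c x.
Proof. by rewrite /c; case: cid => z []. Qed.

Lemma expg_modp (x : G) n : x ^+ (n %% p) = x ^+ n.
Proof. by rewrite {2}(divn_eq n p) expgnDr mulnC expgnA (es_expg HG) expg1n mul1g. Qed.

Lemma expg_FpD (x : G) (k l : 'F_p) : x ^+ (k + l)%R = x ^+ k * x ^+ l.
Proof. by rewrite /= [X in _ %% X](Fp_cast p_prime) expg_modp expgnDr. Qed.

Lemma expg_FpM (x : G) (k l : 'F_p) : x ^+ (k * l)%R = x ^+ k ^+ l.
Proof. by rewrite /= [X in _ %% X](Fp_cast p_prime) expg_modp expgnA. Qed.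

Definition cpow (k : 'F_p) : G := c ^+ k.

Lemma cpowD k l : cpow (k + l)%R = cpow k * cpow l.
Proof. exact: expg_FpD. Qed.

Lemma cpow0 : cpow 0%R = 1.
Proof. by []. Qed.

Lemma cpowC k x : cpow k * x = x * cpow k.
Proof. exact/commute_sym/commuteX/commute_sym/baer_c_central. Qed.

Lemma cpow_inj : injective cpow.
Proof.
move=> k l E; apply/eqP; rewrite -subr_eq0; apply/negPn/negP => d0.
have Ed : cpow (k - l)%R = 1 by rewrite cpowD E -cpowD subrr.
case: baer_c_neq1.
(* A nonzero d is invertible in ['F_p], so that c, being c to the power d / d, is a power of c^d =
   1. *)
rewrite -(expg1 c) -[1%N]/(nat_of_ord (1%R : 'F_p)) -(divff d0) expg_FpM.
by rewrite [c ^+ _]Ed expg1n.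
Qed.

Lemma center_cpow (z : G) : center_set z -> exists k, z = cpow k.
Proof.
have [_ _] := svalP (cid (es_center HG)); move=> Zc /Zc[k ->].
exists (k : nat)%:R%R; rewrite /cpow val_Fp_nat // modn_small //.
Qed.

Definition baer_omega (x y : G) : 'F_p := sval (cid (center_cpow (es_commg HG x y))).
Local Notation omega := baer_omega.

Lemma omegaE x y : [~ x, y] = cpow (omega x y).
Proof. by rewrite /omega; case: cid. Qed.

Lemma mulg_omega x y : x * y = y * x * cpow (omega x y).
Proof. by rewrite -omegaE commgC. Qed.

Lemma omega_eq x y k : x * y = y * x * cpow k -> omega x y = k.
Proof. by rewrite mulg_omega => /mulgI/cpow_inj. Qed.

Lemma omega_eq0 x y : commute x y -> omega x y = 0%R.
Proof. by move=> xy; apply: omega_eq; rewrite cpow0 mulg1. Qed.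

Lemma mulg_cpowl x k y : x * cpow k * y = x * y * cpow k.
Proof. by rewrite -!mulgA cpowC. Qed.

Lemma mulg_cpowA x k l : x * cpow k * cpow l = x * cpow (k + l)%R.
Proof. by rewrite cpowD mulgA. Qed.

Lemma omega_mull x y z : omega (x * y) z = (omega x z + omega y z)%R.
Proof.
apply: omega_eq; rewrite -mulgA (mulg_omega y z) !mulgA (mulg_omega x z).
by rewrite mulg_cpowl mulg_cpowA.
Qed.

Lemma baer_omegaC x y : omega x y = (- omega y x)%R.
Proof.
apply/eqP; rewrite -addr_eq0; apply/eqP; apply: cpow_inj.
apply: (mulgI (x * y)); rewrite addrC cpowD mulgA.
by rewrite -(mulg_omega y x) -mulg_omega mulg1.
Qed.

Lemma omega_mulr x y z : omega z (x * y) = (omega z x + omega z y)%R.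
Proof. by rewrite baer_omegaC omega_mull opprD -!baer_omegaC. Qed.

Lemma omega_cpowl k x : omega (cpow k) x = 0%R.
Proof. by apply: omega_eq0; exact: cpowC. Qed.

Lemma omega_cpowr k x : omega x (cpow k) = 0%R.
Proof. by rewrite baer_omegaC omega_cpowl oppr0. Qed.

Definition half : 'F_p := (2%:R)^-1%R.

Lemma half_double (k : 'F_p) : (half * k + half * k = k)%R.
Proof.
have two0 : (2%:R : 'F_p)%R != 0%R.
  have gt2 : 2 < p by rewrite odd_prime_gt2.
  by apply/eqP => /(congr1 (@nat_of_ord _)); rewrite val_Fp_nat // modn_small.
by rewrite -mulrDr -mulr2n -mulr_natl mulKf.
Qed.

(* The correction by half the commutator makes the product commutative. *)
Definition baer_add (x y : G) : G := x * y * cpow (- (half * omega x y))%R.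

Lemma omega_addl x y z : omega (baer_add x y) z = (omega x z + omega y z)%R.
Proof. by rewrite !omega_mull omega_cpowl addr0. Qed.

Lemma omega_addr x y z : omega z (baer_add x y) = (omega z x + omega z y)%R.
Proof. by rewrite !omega_mulr omega_cpowr addr0. Qed.

Lemma baer_addC : commutative baer_add.
Proof.
move=> x y; rewrite /baer_add (mulg_omega x y) mulg_cpowA; congr (_ * cpow _).
by rewrite (baer_omegaC y x) mulrN opprK -{1}[omega x y]half_double addrK.
Qed.

Lemma baer_addA : associative baer_add.
Proof.
move=> x y z; rewrite {1 3}/baer_add omega_addl omega_addr /baer_add.
rewrite mulg_cpowl !mulgA !mulg_cpowA; congr (_ * cpow _).
by rewrite !mulrDr !opprD addrC !addrA.
Qed.

Lemma baer_add_commute x y : commute x y -> baer_add x y = x * y.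
Proof. by move=> /omega_eq0 E; rewrite /baer_add E mulr0 oppr0 cpow0 mulg1. Qed.

Lemma baer_add0 : left_id 1 baer_add.
Proof. by move=> x; rewrite baer_add_commute ?mul1g //; exact/commute_sym/commute1. Qed.

Lemma baer_addN : left_inverse 1 (fun x : G => x^-1) baer_add.
Proof.
by move=> x; rewrite baer_add_commute ?mulVg //; apply/commute_sym/commuteV.
Qed.

Definition baer_zmod : zmodType := HB.pack_for zmodType (Choice.sort G)
  (GRing.isZmodule.Build G baer_addA baer_addC baer_add0 baer_addN).

(** The two operations agree on commuting elements, in particular on the powers of x; multiples of x
    are therefore its powers, and exponent p makes ['F_p] act. *)
Definition baer_scale (k : 'F_p) (x : G) : G := x ^+ k.

Lemma baer_mulrn (x : baer_zmod) n : (x *+ n)%R = (x : G) ^+ n.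
Proof.
elim: n => // n IH; rewrite mulrS IH expgS.
by apply: baer_add_commute; exact/commuteX.
Qed.

Lemma baer_scaleA k l x : baer_scale k (baer_scale l x) = baer_scale (k * l)%R x.
Proof. by rewrite /baer_scale -expg_FpM mulrC. Qed.

Lemma baer_scale1 : left_id 1%R baer_scale.
Proof. by move=> x; rewrite /baer_scale /= expg1. Qed.

Lemma baer_scaleDr : right_distributive baer_scale (+%R : baer_zmod -> baer_zmod -> baer_zmod).
Proof. by move=> k x y; rewrite /baer_scale -!baer_mulrn mulrnDl. Qed.

Lemma baer_scaleDl (x : baer_zmod) :
  {morph (fun k => baer_scale k x : baer_zmod) : k l / (k + l)%R}.
Proof.
move=> k l; rewrite /baer_scale expg_FpD; symmetry; apply: baer_add_commute.
exact/commuteX2.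
Qed.

Definition baer_space : lmodType 'F_p :=
  HB.pack_for (lmodType 'F_p) (GRing.Zmodule.sort baer_zmod)
  (GRing.Zmodule_isLmodule.Build 'F_p baer_zmod baer_scaleA baer_scale1
     baer_scaleDr baer_scaleDl).

(** The product is recovered from addition, omega and c. Hence a linear partial isomorphism that
    preserves omega and fixes c preserves the product. *)
Lemma baer_mulgE (x y : baer_space) :
  (x : G) * y = (x + y + (half * omega x y) *: (c : baer_space))%R.
Proof.
rewrite [RHS]baer_add_commute; last by apply/commute_sym; exact: cpowC.
by rewrite [RHS]mulg_cpowA addNr cpow0 mulg1.
Qed.

Lemma baer_symplectic : @symplectic _ baer_space omega c.
Proof.
have omegaX x z n : omega (x ^+ n) z = (n%:R * omega x z)%R.
  elim: n => [|n IH]; first by rewrite mul0r; apply: omega_eq0; exact/commute_sym/commute1.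
  by rewrite expgS omega_mull IH mulrS mulrDl mul1r.
split.
- by move=> k x y z; rewrite [LHS]omega_addl [X in (X + _)%R]omegaX natr_Zp.
- exact: baer_omegaC.
- by move=> x; apply: omega_eq0.
- by move=> x; apply: omega_eq0; exact: baer_c_central.
- move=> x Hx; apply: center_cpow => y.
  by have := mulg_omega x y; rewrite Hx cpow0 mulg1.
- exact: es_infinite HG.
Qed.

Lemma group_back_and_forth :
  @back_and_forth _ (group_structure G) (group_structure G)
    (@symplectic_piso _ baer_space omega c).
Proof.
have forth R a := @symplectic_piso_forth _ _ _ _ baer_symplectic R a.
split.
- by move=> R a b a' b' [HR _ _] Rab Rab'; exact: (lpiso_inj HR Rab Rab').
- move=> R [||] a b [HR Rc Rom] Rab /=.
  + by case: HR.
  + exact: (lpisoN HR (Rab ord0)).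
  + rewrite !baer_mulgE; apply: (lpisoD HR); first exact: (lpisoD HR).
    by rewrite (Rom _ _ _ _ (Rab ord0) (Rab ord_max)); exact: (lpisoZ HR).
- by move=> R [].
- by move=> R a; exact: forth.
- move=> R b /symplectic_piso_sym/(forth _ b)[R' [a [HR' RR' R'ab]]].
  exists (fun x y => R' y x), a; split=> [|x y /RR' //|//].
  exact: symplectic_piso_sym.
Qed.

End BaerCorrespondence.

(** * Embedding a graph into a saturated one *)

Section TreeGraph.
Variables (T : eqType) (E : T -> T -> Prop).
Local Notation tree := (GenTree.tree T).

Definition children (t : tree) : seq tree :=
  if t is GenTree.Node _ s then s else [::].

Fixpoint tree_rank (t : tree) : nat :=
  if t is GenTree.Node _ s then (sumn [seq tree_rank u | u <- s]).+1 else 0.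

(** The rank rules out loops and unwanted edges: a tree is never a child of one of smaller or equal
    rank. *)
Lemma rank_children t u : u \in children t -> tree_rank u < tree_rank t.
Proof.
case: t => //= _ s us; rewrite ltnS sumnE big_map (big_rem u us) /=.
exact: leq_addr.
Qed.

(* Each new vertex is joined to an arbitrary finite list of previously built ones. *)
Definition tree_edge (t u : tree) : Prop :=
  [\/ if (t, u) is (GenTree.Leaf x, GenTree.Leaf y) then E x y else False,
      u \in children t | t \in children u].

Lemma tree_edge_leaf x y : tree_edge (GenTree.Leaf x) (GenTree.Leaf y) <-> E x y.
Proof. by split=> [[]|] // Exy; constructor 1. Qed.

Hypotheses (E_irr : forall x, ~ E x x) (E_sym : forall x y, E x y -> E y x).

Lemma tree_saturated : saturated_graph tree_edge.
Proof.
split.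
- by case=> [x|n s] [] //; [exact: E_irr|move/rank_children; rewrite ltnn..].
- move=> t u [Etu|ut|tu]; [constructor 1|constructor 3|constructor 2] => //.
  by case: t u Etu => [x|n s] [y|m s'] //; exact: E_sym.
move=> _ _ /finite_seqP[sA ->] /finite_seqP[sB ->] /seteqP[disj _].
(* The new vertex needs [sA] among its children and no edge to [sB]. The extra child u lifts its
   rank above all of [sA] and [sB], so it is none of them and a child of none; u itself is not in
   [sB], again by rank. *)
pose u := GenTree.Node 0 (sA ++ sB); pose v := GenTree.Node 0 (u :: sA).
have uv : tree_rank u < tree_rank v by apply: (@rank_children v); exact: mem_head.
have rank_lt x : x \in sA ++ sB -> tree_rank x < tree_rank u.
  exact: (@rank_children u).
exists v; split=> [xAB|a aA|b bB].
- have /rank_lt : v \in sA ++ sB by rewrite mem_cat; apply/orP.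
  by rewrite ltnNge ltnW.
- by constructor 2; rewrite in_cons aA orbT.
- have /rank_lt bu : b \in sA ++ sB by rewrite mem_cat bB orbT.
  case=> [|| /rank_children vb] //.
  + rewrite in_cons => /orP[/eqP Eb|bA]; last exact: (disj b).
    by move: bu; rewrite Eb ltnn.
  + by have := ltn_trans uv (ltn_trans vb bu); rewrite ltnn.
Qed.

End TreeGraph.

(** [Hyp2] speaks of countable graphs only. The trees over the empty type form such a graph, and all
    saturated graphs satisfy the same sentences. *)
Lemma Hyp2_saturated (V : Type) (V0 : inhabited V) (E : V -> V -> Prop) :
  saturated_graph E -> models (graph_structure V0 E) Hyp2.
Proof.
move=> HE phi; pose T := GenTree.tree void.
pose E0 := @tree_edge void (fun _ _ => False).
have HE0 : saturated_graph E0 by exact: tree_saturated.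
move=> /(_ T (inhabits (GenTree.Node 0 [::])) E0) H.
apply/(saturated_graph_elementary V0 (inhabits (GenTree.Node 0 [::])) phi HE HE0)/H.
by case: HE0 => irr sym ext; split=> //; exact: countableP.
Qed.

(** * Linear relations in the vector sort of a union *)

Section VectorSortDefinability.
Local Open Scope ring_scope.
Import GRing.Theory.
Variables (p : nat) (V : lmodType 'F_p) (L2 : language) (M2 : structure L2).
Local Notation N := (dunion (vec_structure V) M2).

(** The default 0 lets linear combinations run over tuples of mixed sorts. *)
Definition vec_part (x : N) : V := if x is inl y then y else 0.

Definition vec_comb (W : Type) (l : seq ('F_p * W)) (a : W -> N) : V :=
  \sum_(ki <- l) ki.1 *: vec_part (a ki.2).

Definition args3 (T : Type) (x y z : T) (i : 'I_3) : T :=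
  if val i == 0 then x else if val i == 1 then y else z.

Definition vec_graph (f : fsym (vec_lang p)) (a : 'I_(far f).+1 -> N) : Prop :=
  rint (s := N) (r := Graph1 L2 f) a.
Arguments vec_graph f a : clear implicits.

Local Notation exp_const := (expressible (S := fun _ : unit => N)).

(** The language of the union has no function symbols, so a combination is built up through the
    graphs of scaling and addition, with quantified intermediate values. These graphs hold only on
    the vector sort, whence the condition on [is_inl]. *)
Lemma vec_comb_graph_expressible W (l : seq ('F_p * W)) :
  exp_const (fun _ (a : option W -> N) =>
    all (fun ki => is_inl (a (Some ki.2))) l /\ a None = inl (vec_comb l (a \o Some))).
Proof.
elim: l => [|[k i] l IH].
  apply: (@exp_ext _ unit (fun=> N) (option W) (fun _ a => vec_graph (VZero p) (fun=> a None))).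
    move=> _ a; rewrite /vec_comb big_nil; split=> [[b [-> _]]|[_ ->]] //.
    by exists (@no_args V); split=> // -[].
  by apply: exp_rel => _; exact: texp_var.
(* x is the multiple of the first entry and y the combination of the others. *)
apply: (@exp_ext _ unit (fun=> N) (option W) (fun _ a => exists x y,
    [/\ vec_graph (VScale k) (two x (a (Some i))),
        all (fun ki => is_inl (a (Some ki.2))) l /\ y = inl (vec_comb l (a \o Some)) &
        vec_graph (VAdd p) (args3 (a None) x y)])).
  move=> _ a; rewrite /vec_comb big_cons /=; split.
    move=> [x [y [[b [Ex Hb]] [Hl ->] [b' [E0 Hb']]]]].
    have {}Ex : x = inl (k *: b ord0) := Ex.
    have Ei : a (Some i) = inl (b ord0) := Hb ord0.
    have Ex' : x = inl (b' ord0) := Hb' ord0.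
    have [Ey] : inl (vec_comb l (a \o Some)) = inl (b' ord_max) :> N := Hb' ord_max.
    have {}E0 : a None = inl (b' ord0 + b' ord_max) := E0.
    split; first by rewrite Ei.
    by move: Ex'; rewrite Ex E0 Ei -Ey => -[<-].
  move=> [/andP[ai Hl] E0]; case Ei : (a (Some i)) ai E0 => [z|//] _ E0.
  exists (inl (k *: z)), (inl (vec_comb l (a \o Some))); split=> //.
    by exists (fun=> z).
  exists (two (k *: z) (vec_comb l (a \o Some))); split.
    by rewrite [LHS]E0.
  by case=> [[|[|//]] Hj].
apply: exp_ex; apply: exp_ex.
apply: (@exp_ext _ unit (fun=> N) (option (option (option W))) (fun _ a =>
    vec_graph (VScale k) (two (a (Some None)) (a (Some (Some (Some i))))) /\
    (all (fun ki => is_inl (a (Some (Some (Some ki.2))))) l /\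
     a None = inl (vec_comb l (a \o Some \o Some \o Some))) /\
    vec_graph (VAdd p) (args3 (a (Some (Some None))) (a (Some None)) (a None)))).
  by move=> _ a; split=> [[? [? ?]]|[? ? ?]].
apply: exp_and;
  first by apply: exp_rel => j; rewrite /two; case: (val j == 0); exact: texp_var.
apply: exp_and; first exact: (exp_ren (omap (Some \o Some)) IH).
apply: exp_rel => j; rewrite /args3; case: (val j == 0); first exact: texp_var.
by case: (val j == 1); exact: texp_var.
Qed.

Lemma vec_comb0_expressible W (l : seq ('F_p * W)) :
  exp_const (fun _ (a : W -> N) => all (fun ki => is_inl (a ki.2)) l /\ vec_comb l a = 0).
Proof.
apply: (@exp_ext _ unit (fun=> N) W (fun _ a => exists u,
    vec_graph (VZero p) (fun=> u) /\
    (all (fun ki => is_inl (a ki.2)) l /\ u = inl (vec_comb l a)))).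
  move=> _ a; split=> [[u [[b [Eu _]] [Hl Eu']]]|[Hl E]].
    by split=> //; move: Eu; rewrite /= Eu' => -[].
  exists (inl (vec_comb l a)); split=> //; exists (@no_args V).
  by split=> [|[]//]; rewrite E.
apply: exp_ex; apply: exp_and; last exact: vec_comb_graph_expressible.
by apply: exp_rel => j; exact: texp_var.
Qed.

End VectorSortDefinability.

Lemma omega_span (F : finFieldType) (V : lmodType F) (omega : V -> V -> F) (c : V)
  (I : finType) (v : I -> V) k z : symplectic omega c ->
  omega (span v k) z = (\sum_i k i * omega (v i) z)%R.
Proof.
move=> H; rewrite /span; apply: (big_rec2 (fun x y => omega x z = y)).
  exact: (omega0l H).
by move=> i x y _ <-; rewrite (omegaDl H).
Qed.

Lemma span_option (F : finFieldType) (V : lmodType F) (I : finType) (v : I -> V) (c : V) k :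
  (span (oapp v c) k = k None *: c + span v [ffun i => k (Some i)])%R.
Proof.
rewrite /span (bigD1 None) //=; congr (_ + _)%R.
rewrite (reindex_omap Some id) /=; last by case.
by apply: eq_big => [i|i _]; rewrite ?eqxx // ffunE.
Qed.

Section ExtraspecialTraced.
Local Open Scope ring_scope.
Import GRing.Theory.
Variables (p : nat) (G : groupType).
Hypotheses (p_prime : prime p) (p_odd : odd p) (HG : extraspecial_like p G).

Local Notation V := (baer_space p_prime p_odd HG).
Local Notation omega := (baer_omega p_prime HG : V -> V -> 'F_p).
Local Notation c := (baer_c HG : V).

(** The boolean records whether an element is the left or the right argument of omega, so that a
    symmetric relation can code an antisymmetric form; the tag e selects the value tested. *)
Definition commutator_base (x y : G * 'F_p * bool) : Prop :=
  match x, y with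
  | (g, e, false), (h, e', true) => e = e' /\ omega g h = e
  | (g, e, true), (h, e', false) => e = e' /\ omega h g = e
  | _, _ => False
  end.

Definition commutator_graph : structure graph_lang :=
  @graph_structure (GenTree.tree (G * 'F_p * bool)%type)
    (inhabits (GenTree.Node 0 [::])) (tree_edge commutator_base).

Local Notation N := (dunion (vec_structure V) commutator_graph).

Definition es_tau (g : G) (j : option ('F_p * bool)) : N :=
  if j is Some (e, b) then inr (GenTree.Leaf (g, e, b)) else inl (g : V).

Lemma commutator_traced (I : finType) (i j : I) e :
  @traced _ _ N (group_structure G) _ es_tau I (fun v => omega (v i) (v j) = e).
Proof.
pose x := Var (dunion_lang (vec_lang p) graph_lang)
  (inl (i, Some (e, false)) : (I * option ('F_p * bool)) + N).
pose y := Var (dunion_lang (vec_lang p) graph_lang)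
  (inl (j, Some (e, true)) : (I * option ('F_p * bool)) + N).
exists (@Rel (dunion_lang (vec_lang p) graph_lang) _ (@Rel2 (vec_lang p) graph_lang tt)
  (two x y)) => a /=; split.
  move=> [b [Eb Hb]]; have [E0] := Hb ord0; have [E1] := Hb ord_max.
  move: Eb; rewrite -E0 -E1 => /tree_edge_leaf.
  by case.
move=> Eom; exists (two (GenTree.Leaf (a i, e, false)) (GenTree.Leaf (a j, e, true))).
split; first by constructor 1.
by case=> [[|[|//]] Hk].
Qed.

Lemma span_traced (I : finType) (k : {ffun I -> 'F_p}) e :
  @traced _ _ N (group_structure G) _ es_tau I (fun v => span (v : I -> V) k = e *: c).
Proof.
(* The right-hand side is moved to the left: c enters as a parameter of N with coefficient -e. *)
pose l : seq ('F_p * ((I * option ('F_p * bool)) + N)) :=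
  (- e, inr (inl c)) :: [seq (k i, inl (i, None)) | i <- enum I].
have [phi Hphi] := @vec_comb0_expressible p V _ commutator_graph _ l.
exists phi => a; rewrite (Hphi tt).
have -> : vec_comb l (@tau_val _ _ N (group_structure G) _ es_tau I a) =
    - e *: c + span (a : I -> V) k.
  by rewrite /vec_comb big_cons big_map big_enum.
have -> : all (fun ki => is_inl (@tau_val _ _ N (group_structure G) _ es_tau I a ki.2)) l.
  by apply/allP => ki; rewrite in_cons => /orP[/eqP ->//|/mapP[i _ ->]].
rewrite addrC scaleNr; split=> [[_ /eqP]|E]; first by rewrite subr_eq0 => /eqP.
by rewrite E subrr.
Qed.

Lemma commutator_graph_saturated : saturated_graph (tree_edge commutator_base).
Proof.
apply: tree_saturated.
  by move=> [[g e] []].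
by move=> [[g e] []] [[h e'] []] // [-> E]; split.
Qed.

Lemma dunion_traces_extraspecial :
  models N (dunion_theory (Vec p) Hyp2) /\ str_trace_defines N (group_structure G).
Proof.
have HS := baer_symplectic p_prime p_odd HG.
split.
  move=> phi; apply; last exact: (Hyp2_saturated _ commutator_graph_saturated).
  by move=> psi; apply; exact: symplectic_infinite HS.
apply: (@trace_criterion _ _ N (group_structure G) _ es_tau _ _
  (group_back_and_forth p_prime p_odd HG)).
  by move=> g h /(congr1 (fun f => f None)) [].
move=> I; exists (({ffun I -> 'F_p} * 'F_p) + (I * I * 'F_p))%type.
exists (fun k v => match k with
  | inl (k, e) => span (v : I -> V) k = e *: c
  | inr (i, j, e) => omega (v i) (v j) = e
  end); split=> [[[k e]|[[i j] e]]|v w vw].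
- exact: span_traced.
- exact: commutator_traced.
(* Members of the family must fix c, so c is adjoined to both tuples at index [None]. Linear
   relations of the longer tuples are the traced equations that express a combination as a multiple
   of c. *)
pose v' := oapp (v : I -> V) c; pose w' := oapp (w : I -> V) c.
have Hom i j : omega (v' i) (v' j) = omega (w' i) (w' j).
  case: i j => [i|] [j|] /=.
  - by apply/esym/(vw (inr (i, j, _))).
  - by rewrite !(omegaC HS _ c) !(omega_c HS).
  - by rewrite !(omega_c HS).
  - by rewrite !(omega_c HS).
exists (fun x y => exists k, x = span v' k /\ y = span w' k); split; last first.
  by move=> i; exists [ffun j => (j == Some i)%:R]; rewrite !span1.
split.
- apply: span_linear_piso => k; rewrite !span_option.
  have E (u : I -> V) : k None *: c + span u [ffun i => k (Some i)] = 0 <->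
      span u [ffun i => k (Some i)] = - k None *: c.
    rewrite scaleNr; split=> [/eqP|->]; last by rewrite subrr.
    by rewrite addrC addr_eq0 => /eqP.
  by rewrite !E; exact: (vw (inl (_, _))).
- by exists [ffun j => (j == None)%:R]; rewrite !span1.
move=> _ _ _ _ [k [-> ->]] [l [-> ->]].
rewrite !(omega_span _ _ _ HS); apply: eq_bigr => i _; congr (_ * _).
rewrite !(omegaC HS _ (span _ _)) !(omega_span _ _ _ HS); congr (- _).
by apply: eq_bigr => j _; rewrite Hom.
Qed.

End ExtraspecialTraced.

(** * A vector space and a graph are traced by a Heisenberg group *)

Section SeparatingFunctional.
Local Open Scope ring_scope.
Import GRing.Theory.
Variables (F : fieldType) (A : lmodType F).

Definition linear_functional (f : A -> F) : Prop :=
  forall k x y, f (k *: x + y) = k * f x + f y.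

(* A subspace maximal among those avoiding a is a complement of the line of a. *)
Lemma separating_functional (a : A) :
  a <> 0 -> exists f, linear_functional f /\ f a = 1.
Proof.
move=> a0.
pose P (S : set A) := (forall k x y, S x -> S y -> S (k *: x + y)) /\ ~ S a.
have [|S [[Slin nSa] maxS]] := @Zorn_bigcup A P.
  move=> FF FP tot; split=> [k x y [X FX Xx] [Y FY Yy]|[X FX Xa]]; last first.
    by case: (FP X FX).
  have [XY|YX] := tot X Y FX FY.
    by exists Y => //; apply: (FP Y FY).1 => //; exact: XY.
  by exists X => //; apply: (FP X FX).1 => //; exact: YX.
(* The empty set also satisfies P, so that S must be shown to be a subspace: an empty S would be
   smaller than the zero space. *)
have S0 : S 0.
  apply: contrapT => nS0.
  have nS x : ~ S x by move=> Sx; have := Slin (-1) x x Sx Sx; rewrite scaleN1r addNr.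
  apply: (maxS [set 0]); first by split=> [x /nS|/(_ 0 erefl)].
  by split=> [k x y -> ->|/a0//]; rewrite scaler0 addr0.
have SZ k x : S x -> S (k *: x) by move=> Sx; rewrite -[_ *: x]addr0; exact: Slin.
have decomp w : exists k, S (w - k *: a).
  have [Sw|nSw] := EM (S w); first by exists 0; rewrite scale0r subr0.
  pose S' := [set u | exists k s, S s /\ u = k *: w + s].
  (* Otherwise the sum of S and the line of w would be a larger subspace avoiding a. Solving for w
     then gives the coefficient. *)
  have S'a : S' a.
    apply: contrapT => nS'a; apply: (maxS S'); split=> //.
    - by move=> x Sx; exists 0, x; rewrite scale0r add0r.
    - by move=> /(_ w) S'S; apply: nSw; apply: S'S; exists 1, 0; rewrite scale1r addr0.
    move=> l _ _ [k [s [Ss ->]]] [k' [s' [Ss' ->]]].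
    exists (l * k + k'), (l *: s + s'); split; first exact: Slin.
    by rewrite scalerDr scalerA scalerDl addrACA.
  have [k [s [Ss Ea]]] := S'a; have [k0|k0] := eqVneq k 0.
    by case: nSa; rewrite Ea k0 scale0r add0r.
  exists k^-1; rewrite Ea scalerDr scalerA mulVf // scale1r opprD addrA subrr add0r.
  by rewrite -scaleNr; exact: SZ.
have uniq w k l : S (w - k *: a) -> S (w - l *: a) -> k = l.
  move=> Sk Sl; apply/eqP; rewrite -subr_eq0; apply/negPn/negP => d0.
  apply: nSa; rewrite -[a]scale1r -(mulVf d0) -scalerA; apply: SZ.
  have := Slin (-1) _ _ Sk Sl; rewrite scaleN1r opprB addrA subrK.
  by rewrite scalerBl.
(* f w is the coordinate of w along a; linearity follows from its uniqueness. *)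
have [f Hf] := choice decomp.
exists f; split=> [k x y|]; last by apply: uniq (Hf a) _; rewrite scale1r subrr.
apply: uniq (Hf _) _; have := Slin k _ _ (Hf x) (Hf y).
by rewrite scalerBr scalerA scalerDl opprD addrACA.
Qed.

End SeparatingFunctional.

(** * The Heisenberg group of a vector space and its full dual *)

Section HeisenbergGroup.
Local Open Scope ring_scope.
Import GRing.Theory.
Variables (p : nat) (A : lmodType 'F_p).

(** The triple (a, f, s) stands for the unitriangular matrix with first row 1, f, s and last column
    s, a, 1; [heis_mul] is the matrix product. *)
Record heis := Heis {
  heis_vec : A;
  heis_dual : A -> 'F_p;
  heis_center : 'F_p;
  heis_linear : linear_functional heis_dual }.

Lemma heis_eq (x y : heis) : heis_vec x = heis_vec y ->
  (forall a, heis_dual x a = heis_dual y a) -> heis_center x = heis_center y -> x = y.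
Proof.
case: x y => [a f s Hf] [b g t Hg] /= -> /funext Ef ->.
by subst g; rewrite (Prop_irrelevance Hf Hg).
Qed.

Lemma heis_dualD x a b : heis_dual x (a + b) = heis_dual x a + heis_dual x b.
Proof. by have := heis_linear x 1 a b; rewrite scale1r mul1r. Qed.

Lemma heis_dual0 x : heis_dual x 0 = 0.
Proof. by apply: (addrI (heis_dual x 0)); rewrite -heis_dualD !addr0. Qed.

Lemma heis_dualN x a : heis_dual x (- a) = - heis_dual x a.
Proof. by apply/eqP; rewrite -addr_eq0 -heis_dualD addNr heis_dual0. Qed.

Lemma zero_functional : linear_functional (fun _ : A => 0 : 'F_p).
Proof. by move=> k x y; rewrite mulr0 addr0. Qed.

Definition heis_one := Heis 0 0 zero_functional.

Lemma heis_inv_linear x : linear_functional (fun a => - heis_dual x a).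
Proof. by move=> k a b; rewrite heis_linear opprD mulrN. Qed.

Definition heis_inv x :=
  Heis (- heis_vec x) (heis_dual x (heis_vec x) - heis_center x) (heis_inv_linear x).

Lemma heis_mul_linear x y : linear_functional (fun a => heis_dual x a + heis_dual y a).
Proof. by move=> k a b; rewrite !heis_linear mulrDr addrACA. Qed.

Definition heis_mul x y :=
  Heis (heis_vec x + heis_vec y)
    (heis_center x + heis_center y + heis_dual x (heis_vec y)) (heis_mul_linear x y).

Lemma heis_mulA : associative heis_mul.
Proof.
move=> x y z; apply: heis_eq => [|a|] /=; rewrite ?addrA //.
rewrite heis_dualD -!addrA; congr (_ + (_ + _)).
by rewrite [RHS]addrCA; congr (_ + _); rewrite addrC -addrA.
Qed.

Lemma heis_mul1 : left_id heis_one heis_mul.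
Proof. by move=> x; apply: heis_eq => [|a|] /=; rewrite ?addr0 add0r. Qed.

Lemma heis_mulr1 : right_id heis_one heis_mul.
Proof. by move=> x; apply: heis_eq => [|a|] /=; rewrite ?heis_dual0 !addr0. Qed.

Lemma heis_mulV : left_inverse heis_one heis_inv heis_mul.
Proof. by move=> x; apply: heis_eq => [|a|] /=; rewrite ?addNr // subrK subrr. Qed.

Lemma heis_mulrV : right_inverse heis_one heis_inv heis_mul.
Proof.
move=> x; apply: heis_eq => [|a|] /=; rewrite ?subrr // heis_dualN.
by rewrite [heis_dual x _ - _]addrC addrA subrr add0r subrr.
Qed.

HB.instance Definition _ := gen_eqMixin heis.
HB.instance Definition _ := gen_choiceMixin heis.
HB.instance Definition _ :=
  isGroup.Build heis heis_mulA heis_mul1 heis_mulr1 heis_mulV heis_mulrV.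

Definition heis_z (k : 'F_p) : heis := Heis 0 k zero_functional.

Definition heis_of_vec (a : A) : heis := Heis a 0 zero_functional.

Definition heis_of_dual (f : A -> 'F_p) (Hf : linear_functional f) : heis := Heis 0 0 Hf.

Lemma heis_commg (x y : heis) :
  ([~ x, y] = heis_z (heis_dual x (heis_vec y) - heis_dual y (heis_vec x)))%g.
Proof.
apply: (mulgI (y * x)%g); rewrite -commgC; apply: heis_eq => [|a|] /=.
- by rewrite addr0 addrC.
- by rewrite addr0 addrC.
rewrite !heis_dual0 !addr0 -[RHS]addrA [heis_dual y _ + _]addrC subrK.
by congr (_ + _); exact: addrC.
Qed.

Lemma heis_z_inj : injective heis_z.
Proof. by move=> k l /(congr1 heis_center). Qed.

Lemma heis_commute (x y : heis) :
  commute x y <-> heis_dual x (heis_vec y) = heis_dual y (heis_vec x).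
Proof.
split=> [/commgP/eqP|E]; last first.
  by apply/commgP/eqP; rewrite heis_commg E subrr; exact: heis_eq.
by rewrite heis_commg => /(congr1 heis_center)/eqP; rewrite subr_eq0 => /eqP.
Qed.

(** Each pair of factors contributes one value of the dual part at the vector part, whence
    ['C(n, 2)]. *)
Lemma heis_expg (x : heis) n :
  [/\ heis_vec (x ^+ n)%g = heis_vec x *+ n,
      forall a, heis_dual (x ^+ n)%g a = heis_dual x a *+ n &
      heis_center (x ^+ n)%g = heis_center x *+ n + heis_dual x (heis_vec x) *+ 'C(n, 2)].
Proof.
elim: n => [|n [IHv IHd IHc]]; first by rewrite addr0.
rewrite expgS; split=> [|a|] /=; rewrite ?IHv ?IHd ?IHc ?mulrS //.
rewrite binS bin1 mulrnDr -!addrA; congr (_ + (_ + _)).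
congr (_ + _); elim: (n) => [|m IHm]; first by rewrite heis_dual0.
by rewrite !mulrS heis_dualD IHm.
Qed.

Lemma heis_z_expg k n : (heis_z k ^+ n)%g = heis_z (k *+ n).
Proof.
have [Ev Ed Ec] := heis_expg (heis_z k) n; apply: heis_eq => [|a|] /=.
- by rewrite Ev mul0rn.
- by rewrite Ed mul0rn.
- by rewrite Ec mul0rn addr0.
Qed.

Hypotheses (p_prime : prime p) (p_odd : odd p) (A_infinite : infinite_set [set: A]).

Lemma Fp_mulrn (k : 'F_p) : k *+ p = 0.
Proof. by rewrite -mulr_natl pchar_Fp_0 // mul0r. Qed.

Lemma heis_center_set : @center_set heis = range heis_z.
Proof.
apply/seteqP; split=> [x Zx|_ [k _ <-] y]; last first.
  by apply/heis_commute; rewrite /= heis_dual0.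
have Ed a : heis_dual x a = 0.
  by have /heis_commute/= := Zx (heis_of_vec a).
have Ev : heis_vec x = 0.
  (* The full dual detects every nonzero vector, which leaves only the third coordinate in the
     center. *)
  apply: contrapT => /separating_functional[f [Hf f1]].
  have /heis_commute/= := Zx (heis_of_dual Hf); rewrite heis_dual0 f1.
  by move/eqP; rewrite eq_sym oner_eq0.
by exists (heis_center x) => //; exact: heis_eq.
Qed.

Lemma heis_extraspecial : is_extraspecial p heis.
Proof.
split.
- move=> x; have [Ev Ed Ec] := heis_expg x p; apply: heis_eq => [|a|] /=.
  + by rewrite Ev -scaler_nat pchar_Fp_0 // scale0r.
  + by rewrite Ed Fp_mulrn.
  have /dvdnP[m Em] : (p %| 'C(p, 2))%N by rewrite prime_dvd_bin //= odd_prime_gt2.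
  by rewrite Ec Em Fp_mulrn mulrnA Fp_mulrn addr0.
- rewrite heis_center_set; apply/seteqP; split; last first.
    apply: smallest_sub; last by move=> _ [x [y ->]]; rewrite heis_commg; eexists.
    split=> [|_ _ [k _ <-] [l _ <-]]; first by exists 0 => //; exact: heis_eq.
    exists (k - l) => //; apply: heis_eq => [|a|] /=; rewrite ?oppr0 ?addr0 //.
    by rewrite add0r.
  have [a a0] : exists a : A, a <> 0 by exact: infinite_escape A_infinite (finite_set1 0).
  have [f [Hf f1]] := separating_functional a0.
  move=> _ [k _ <-]; apply: sub_gen_smallest.
  (* Since f a = 1, this commutator has value k: every central element is a single commutator. *)
  exists (heis_of_dual Hf), (heis_of_vec (k *: a)); rewrite heis_commg /=.
  by rewrite subr0 -[_ *: a]addr0 Hf f1 mulr1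
    -[f 0]/(heis_dual (heis_of_dual Hf) 0) heis_dual0 addr0.
- exists (heis_z 1); rewrite heis_center_set; apply/seteqP; split=> _ [k _ <-].
    by exists (nat_of_ord k) => //; rewrite heis_z_expg natr_Zp.
  by exists (k%:R) => //; rewrite heis_z_expg.
- rewrite heis_center_set; apply: card_eq_trans (inj_card_eq (in2W heis_z_inj)) _.
  have := card_esym (@card_II (Zp_trunc (pdiv p)).+2).
  by rewrite [X in (_ #= `I_X)%card]Fp_cast.
Qed.

Lemma heis_infinite : infinite_set [set: heis].
Proof.
move=> fin; apply: A_infinite.
apply: sub_finite_set (finite_image heis_vec fin) => a _.
by exists (heis_of_vec a).
Qed.

End HeisenbergGroup.

Section VectorBackAndForth.
Variables (p : nat) (V W : lmodType 'F_p).
Hypotheses (V_infinite : infinite_set [set: V]) (W_infinite : infinite_set [set: W]).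

Lemma vector_back_and_forth :
  @back_and_forth _ (vec_structure V) (vec_structure W) (@linear_piso _ V W).
Proof.
split.
- by move=> R a b a' b' HR; exact: lpiso_inj.
- move=> R [|||k] a b HR Rab /=.
  + by case: HR.
  + exact: (lpisoN HR).
  + exact: (lpisoD HR).
  + exact: (lpisoZ HR).
- by move=> R [].
- by move=> R a HR; exact: linear_piso_forth.
- move=> R b /lpiso_sym/(linear_piso_forth b V_infinite)[R' [a [HR' RR' R'ab]]].
  by exists (fun x y => R' y x), a; split=> [|x y /RR'|//]; first exact: lpiso_sym.
Qed.

End VectorBackAndForth.

(** * Coding vectors and vertices in the Heisenberg group *)

Section VectorGraphTraced.
Local Open Scope ring_scope.
Import GRing.Theory.
Variables (p : nat) (V : lmodType 'F_p) (T : Type) (T0 : inhabited T).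
Variable E : T -> T -> Prop.

Local Notation A := (V * (T -> ('F_p)^o))%type.
Local Notation H := (heis A).
Local Notation M := (dunion (vec_structure V) (graph_structure T0 E)).
Local Notation N := (group_structure H).
Local Notation part := (@vec_part p V _ (graph_structure T0 E)).

Lemma evaluation_linear (g : T) : @linear_functional _ A (fun a => a.2 g).
Proof. by []. Qed.

(** A neighbourhood may be infinite, so A has to contain all functions on T and not only those of
    finite support. *)
Definition neighbours (g : T) : A := (0, fun h => if `[< E g h >] then 1 else 0).

(* The commutator of the second coordinate of g and the third one of h is the
   value at g of the indicator function of the neighbours of h. *)
Definition vg_tau (x : M) (j : option bool) : H :=
  match x, j with
  | inl v, None => heis_of_vec ((v, 0) : A)
  | inr g, Some false => heis_of_dual (evaluation_linear g)
  | inr g, Some true => heis_of_vec (neighbours g)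
  | _, _ => 1%g
  end.

Lemma vg_tau_sort x : vg_tau x (Some false) = 1%g <-> exists v, x = inl v.
Proof.
case: x => [v|g] /=; split=> //; first by exists v.
  move=> /(congr1 (fun h => heis_dual h (0, fun=> 1)))/eqP.
  by rewrite /= oner_eq0.
by case.
Qed.

(** The trivial coordinate of a vertex matches the default 0 of [vec_part]; linear relations can
    therefore be read off without knowing the sorts. *)
Lemma vg_tau_part x : vg_tau x None = heis_of_vec ((part x, 0) : A).
Proof. by case: x => //= g; exact: heis_eq. Qed.

Lemma vg_tau_edge x y :
  commute (vg_tau x (Some false)) (vg_tau y (Some true)) <->
  ~ (exists g h, [/\ x = inr g, y = inr h & E h g]).
Proof.
rewrite heis_commute; case: x => [v|g] /=.
  by split=> [_ [g [h []]]|_] //; case: y => [w|h] //=.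
case: y => [w|h] /=; first by split=> // _ [? [? []]].
have [Ehg|nE] := pselect (E h g).
  rewrite asboolT //; split=> [/eqP|[]]; first by rewrite oner_eq0.
  by exists g, h.
rewrite asboolF //; split=> // _ [g' [h' [[<-] [<-]]]] //.
Qed.

Lemma vg_tau_inj : injective vg_tau.
Proof.
move=> x y Exy; have Ej j : vg_tau x j = vg_tau y j by rewrite Exy.
have := vg_tau_sort x; rewrite (Ej (Some false)) vg_tau_sort.
case: x y {Exy} Ej => [v|g] [w|h] Ej Hs.
- by have /(congr1 (fun h => (heis_vec h).1))/= -> := Ej None.
- by have [_ []] := Hs; [exists v|].
- by have [[]] := Hs; [exists w|].
(* The indicator function of g separates evaluation at g from evaluation at any other vertex. *)
pose delta_g : A := (0, fun t => if `[< t = g >] then 1 else 0).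
have /(congr1 (fun u => heis_dual u delta_g))/= := Ej (Some false).
rewrite asboolT //; have [->//|nE] := pselect (h = g).
by rewrite asboolF // => /eqP; rewrite oner_eq0.
Qed.

Definition gterm (W : Type) := term group_lang W.
Definition tone W : gterm W := @App group_lang W GOne (@no_args _).
Definition tmul W (t u : gterm W) : gterm W := @App group_lang W GMul (two t u).

(** A linear combination written as a product of powers, with the coefficients read as natural
    numbers: elements of A multiply in the group as they add. *)
Definition tcomb W (I : Type) (x : I -> W) (k : I -> 'F_p) (s : seq I) : gterm W :=
  foldr (fun i => tmul (iter (k i) (tmul (Var group_lang (x i))) (tone W))) (tone W) s.

Lemma heis_of_vecD (a b : A) : heis_of_vec (a + b) = (heis_of_vec a * heis_of_vec b)%g.
Proof. by apply: heis_eq => [|c|] /=; rewrite ?addr0. Qed.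

Lemma eval_tcomb W (I : Type) (x : I -> W) k s (a : W -> N) (b : I -> V) :
  (forall i, a (x i) = heis_of_vec ((b i, 0) : A)) ->
  eval a (tcomb x k s) = heis_of_vec ((\sum_(i <- s) k i *: b i, 0) : A).
Proof.
move=> Hab; elim: s => [|i s IH]; first by rewrite big_nil; exact: heis_eq.
have -> : eval a (tcomb x k (i :: s)) =
    ((eval a (iter (k i) (tmul (Var group_lang (x i))) (tone W)) : H) *
    (eval a (tcomb x k s) : H))%g by [].
rewrite IH big_cons.
have -> : ((k i *: b i + \sum_(j <- s) k j *: b j, 0) : A) =
    (k i *: b i, 0) + (\sum_(j <- s) k j *: b j, 0).
  by congr pair; rewrite addr0.
rewrite heis_of_vecD; congr (_ * _)%g.
rewrite -[k i in RHS]natr_Zp scaler_nat; elim: (nat_of_ord (k i)) => [|n IHn].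
  exact: heis_eq.
rewrite mulrS.
have -> : ((b i + b i *+ n, 0) : A) = (b i, 0) + (b i *+ n, 0).
  by congr pair; rewrite addr0.
by rewrite heis_of_vecD -IHn -Hab.
Qed.

Local Notation tracedM := (@traced _ _ N M _ vg_tau).

Variable I : finType.
Local Notation W := ((I * option bool) + N)%type.

Definition coord (i : I) (j : option bool) : gterm W := Var group_lang (inl (i, j)).

Lemma sort_traced i : tracedM (fun v : I -> M => exists x, v i = inl x).
Proof.
exists (Eq (coord i (Some false)) (tone W)) => v; rewrite -vg_tau_sort /=.
by [].
Qed.

Lemma eq_traced i j : tracedM (fun v : I -> M => v i = v j).
Proof.
exists (BigAnd (fun k => Eq (coord i k) (coord j k))) => v; rewrite sat_BigAnd.
split=> [Hk|Ev k]; last exact: (congr1 (fun x => vg_tau x k) Ev).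
by apply: vg_tau_inj; apply: funext => k; exact: Hk k.
Qed.

Lemma part_traced (k : {ffun I -> 'F_p}) :
  tracedM (fun v : I -> M => span (part \o v) k = 0).
Proof.
exists (Eq (tcomb (fun i => inl (i, None) : W) k (enum I)) (tone W)) => v.
rewrite /= (eval_tcomb _ _ (b := part \o v)) => [|i]; last exact: vg_tau_part.
rewrite big_enum -/(span _ k); split=> [/(congr1 (fun h => (heis_vec h).1))|->] //.
Qed.

Lemma edge_traced i j :
  tracedM (fun v : I -> M => exists g h, [/\ v i = inr g, v j = inr h & E h g]).
Proof.
pose x := coord i (Some false); pose y := coord j (Some true).
exists (Neg (Eq (tmul x y) (tmul y x))) => v; rewrite sat_Neg.
split=> [nc|Hex xy]; last exact: (vg_tau_edge (v i) (v j)).1 xy Hex.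
by apply: contrapT => /vg_tau_edge xy; apply: nc.
Qed.

End VectorGraphTraced.

Section VectorGraphTraces.
Local Open Scope ring_scope.
Import GRing.Theory.
Variables (p : nat) (V : lmodType 'F_p) (T : Type) (T0 : inhabited T).
Variable E : T -> T -> Prop.
Hypotheses (p_prime : prime p) (p_odd : odd p).
Hypotheses (V_infinite : infinite_set [set: V]) (E_saturated : saturated_graph E).

Local Notation A := (V * (T -> ('F_p)^o))%type.
Local Notation M := (dunion (vec_structure V) (graph_structure T0 E)).
Local Notation N := (group_structure (heis A)).
Local Notation part := (@vec_part p V _ (graph_structure T0 E)).

Lemma extraspecial_traces_dunion : models N (ES p) /\ str_trace_defines N M.
Proof.
have [_ sym _] := E_saturated.
split.
  have A_infinite : infinite_set [set: A].
    move=> fin; apply: V_infinite; apply: sub_finite_set (finite_image fst fin) => v _.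
    by exists (v, 0).
  by move=> phi; apply; [exact: heis_infinite|exact: heis_extraspecial].
have bf := dunion_back_and_forth (vector_back_and_forth V_infinite V_infinite)
  (graph_back_and_forth T0 T0 E_saturated E_saturated).
apply: (@trace_criterion _ _ N M _ (@vg_tau p V T T0 E) _ (@vg_tau_inj p V T T0 E) bf).
(* Linear relations decide the vector entries, equalities and edges the vertices, and the first
   family of conditions keeps the sorts apart. *)
move=> I; exists (I + {ffun I -> 'F_p} + (I * I) + (I * I))%type.
exists (fun k (v : I -> M) => match k with
  | inl (inl (inl i)) => exists x, v i = inl x
  | inl (inl (inr k)) => span (part \o v) k = 0
  | inl (inr (i, j)) => v i = v j
  | inr (i, j) => exists g h, [/\ v i = inr g, v j = inr h & E h g]
  end); split=> [[[[i|k]|[i j]]|[i j]]|v w vw].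
- exact: sort_traced.
- exact: part_traced.
- exact: eq_traced.
- exact: edge_traced.
pose R1 x y := exists k, x = span (part \o v) k /\ y = span (part \o w) k.
pose R2 (x y : T) := exists i, v i = inr x /\ w i = inr y.
exists (rel_sum R1 R2); split.
  exists R1, R2; split=> //.
    by apply: span_linear_piso => k; exact: (vw (inl (inl (inr k)))).
  split.
  - have finI := finite_image (fun i => (v i, w i)) (@finite_finset I setT).
    have [t0] := T0.
    (* [t0] is a dummy value for pairs that do not consist of two vertices. *)
    pose f (xy : M * M) : T * T := if xy is (inr x, inr y) then (x, y) else (t0, t0).
    apply: sub_finite_set (finite_image f finI) => -[x y] [i [/= vi wi]].
    by exists (v i, w i); [exists i|rewrite vi wi].
  - move=> x y x' y' [i [vi wi]] [j [vj wj]]; have := vw (inl (inr (i, j))).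
    rewrite /= vi vj wi wj => -[Eij Eji]; split=> [xx|yy].
      by have [] : inr y = inr y' :> M by apply: Eij; rewrite xx.
    by have [] : inr x = inr x' :> M by apply: Eji; rewrite yy.
  - move=> x y x' y' [i [vi wi]] [j [vj wj]].
    have edgeE (a b : T) :
        (exists g h, [/\ inr a = inr g :> M, inr b = inr h :> M & E h g]) <-> E b a.
      by split=> [[g [h [[<-] [<-]]]]|Eba] //; exists a, b.
    have := vw (inr (i, j)); rewrite /= vi vj wi wj !edgeE => Eij.
    by split=> /sym/Eij/sym.
move=> i; have := vw (inl (inl (inl i))) => /= Hi.
case Ev : (v i) Hi => [x|x]; case Ew : (w i) => [y|y] Hi /=.
- exists [ffun j => (j == i)%:R]; rewrite !span1 /=.
  by rewrite Ev Ew.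
- by have [z] : exists z, inr y = inl z :> M by apply/Hi; exists x.
- by have [z] : exists z, inr x = inl z :> M by apply/Hi; exists y.
- by exists i.
Qed.

End VectorGraphTraces.

Theorem proposition4p2 (p : nat) (hp : prime p) (hodd : odd p) :
  trace_equivalent (ES p) (dunion_theory (Vec p) Hyp2).
Proof.
split=> M; last first.
  move=> /(ES_model hp)[G [HG ->]].
  by have [HN tr] := dunion_traces_extraspecial hp hodd HG; eexists; split; [exact: HN|].
move=> /dunion_theory_split[M1 [M2 [h [/Vec_model[V [infV E1]]]]]].
move=> /Hyp2_model[T [T0 [E [HE E2]]]] Hh.
subst M1 M2; have [HN tr] := extraspecial_traces_dunion T0 hp hodd infV HE.
by eexists; split; [exact: HN|exact: str_trace_defines_isomorphism Hh tr].
Qed.
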